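(* Let $(M,g)$ be a Riemannian manifold of dimension $n\geq 4$ and let $k$ be an integer with $0\leq 2k\leq n$. (a) If $(M,g)$ is conformally flat, then $$h_{2k}=\frac{(n-k)!\,k!}{(n-2k)!}\,\sigma_k .$$ (b) For an arbitrary $(M,g)$ (not necessarily conformally flat), $$h_{2k}=\frac{(n-k)!\,k!}{(n-2k)!}\,\sigma_k+\sum_{i=0}^{k-1}\frac{k!}{i!\,(k-i)!\,(n-2k)!}\,\bigl\langle *(g^{n-2k+i}A^i),\,W^{k-i}\bigr\rangle .$$
   Context: Manifolds are smooth and without boundary. A $(p,q)$ double form is a section of $\Lambda^pT^*M\otimes\Lambda^qT^*M$. The exterior (Kulkarni–Nomizu) product is $(\omega_1\otimes\omega_2)(\theta_1\otimes\theta_2)=(\omega_1\wedge\theta_1)\otimes(\omega_2\wedge\theta_2)$, so that for a symmetric bilinear form $h$ (a $(1,1)$ double form) $h^k(x_1,\dots,x_k;y_1,\dots,y_k)=k!\det[h(x_i,y_j)]$; juxtaposition and powers denote this product. The metric $g$ is a $(1,1)$ double form. The contraction is $c\,\omega(x_2,\dots,x_p;y_2,\dots,y_q)=\sum_i\omega(e_i,x_2,\dots,x_p;e_i,y_2,\dots,y_q)$ for an orthonormal basis $(e_i)$, and $c^r$ is its $r$-th iterate. The Hodge operator on double forms is $*(\omega_1\otimes\omega_2)=( *\omega_1)\otimes( *\omega_2)$. The inner product $\langle\cdot,\cdot\rangle$ is the one for which the $e^*_I\otimes e^*_J$ ($I,J$ increasing multi-indices) are orthonormal. $R$ is the covariant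 Riemann curvature tensor seen as a $(2,2)$ double form, with sign such that $R(x,y;x,y)$ is the sectional curvature for orthonormal $x,y$; thus $cR=Ric$, $c^2R=Scal$. The decomposition $R=W+gA$, with $W$ the Weyl tensor ($cW=0$) and $A$ a symmetric bilinear form, defines the Schouten tensor $A=\frac{1}{n-2}\bigl(Ric-\frac{Scal}{2(n-1)}g\bigr)$. The $(2k)$-th Gauss–Bonnet curvature is the function $$h_{2k}=\frac{1}{(n-2k)!}*\bigl(g^{n-2k}R^k\bigr)=\frac{c^{2k}R^k}{(2k)!},\qquad h_0=1,$$ and the $\sigma_k$-curvature is the $k$-th elementary symmetric function of the eigenvalues of $A$ with respect to $g$: $$\sigma_k=\frac{1}{(k!)^2}c^kA^k=\frac{1}{(n-k)!\,k!}*(g^{n-k}A^k).$$ *)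

(* Defs.v *)
From HB Require Import structures.
From mathcomp Require Import all_boot all_order all_algebra.
From mathcomp Require Import all_classical all_reals all_analysis.

Set Implicit Arguments.
Unset Strict Implicit.
Unset Printing Implicit Defensive.

Import Order.TTheory GRing.Theory Num.Theory.
Import numFieldNormedType.Exports.

Local Open Scope ring_scope.

(** * Smooth functions on open subsets of R^n *)

Definition partial (R : realType) (n : nat) (i : 'I_n) (f : 'rV[R]_n -> R) :
    'rV[R]_n -> R :=
  fun x => 'D_(delta_mx 0 i) f x.

Fixpoint Ck_on (R : realType) (n m : nat) (D : set 'rV[R]_n)
    (f : 'rV[R]_n -> R) : Prop :=
  match m with
  | 0%N => forall x, D x -> {for x, continuous f}
  | m'.+1 => (forall x, D x -> differentiable f x) /\
             (forall i : 'I_n, Ck_on m' D (partial i f))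
  end.

Definition smooth_on (R : realType) (n : nat) (D : set 'rV[R]_n)
    (f : 'rV[R]_n -> R) : Prop :=
  forall m, Ck_on m D f.

(** * Smooth manifolds without boundary, given by a smooth atlas *)

(* The functions [chart i] and [chart_inv i] are total; only their values on
   [dom i] and [chart_image i] are meaningful. *)
Record smooth_manifold (R : realType) (n : nat) := SmoothManifold {
  mpoint :> topologicalType;
  mpoint_hausdorff : hausdorff_space mpoint;
  mpoint_countable : @second_countable mpoint;
  chart_index : Type;
  dom : chart_index -> set mpoint;
  chart : chart_index -> mpoint -> 'rV[R]_n;
  chart_inv : chart_index -> 'rV[R]_n -> mpoint;
  chart_image := fun (i : chart_index) (V : set mpoint) =>
    (chart i @` (dom i `&` V))%classic;
  dom_open : forall i, open (dom i);
  dom_cover : forall p, exists i, dom i p;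
  chart_image_open : forall i, open (chart_image i setT);
  chartK : forall i p, dom i p -> chart_inv i (chart i p) = p;
  chart_continuous :
    forall i p, dom i p -> {for p, continuous (chart i)};
  chart_inv_continuous :
    forall i x, chart_image i setT x -> {for x, continuous (chart_inv i)};
  transition_smooth : forall i j (a : 'I_n),
    smooth_on (chart_image i (dom j))
              (fun x => chart j (chart_inv i x) 0 a)
}.

Definition transition (R : realType) (n : nat) (M : smooth_manifold R n)
    (i j : chart_index M) : 'rV[R]_n -> 'rV[R]_n :=
  fun x => chart j (chart_inv i x).

Definition smooth_fun_on (R : realType) (n : nat) (M : smooth_manifold R n)
    (V : set M) (f : M -> R) : Prop :=
  forall i : chart_index M,
    smooth_on (chart_image i V) (fun x => f (chart_inv i x)).

(** * Riemannian metrics *)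

Definition bilin (R : realType) (n : nat) (G : 'M[R]_n) (u v : 'rV[R]_n) : R :=
  (u *m G *m v^T) 0 0.

(* [gmx i x] is the matrix (g_ab) at the point of coordinates x in chart i;
   tangent vectors are row vectors, on which the differential of a map acts by
   right multiplication by its Jacobian matrix. *)
Record riemannian_metric (R : realType) (n : nat)
    (M : smooth_manifold R n) := RiemannianMetric {
  gmx : chart_index M -> 'rV[R]_n -> 'M[R]_n;
  gmx_sym : forall i x, chart_image i setT x -> (gmx i x)^T = gmx i x;
  gmx_posdef : forall i x, chart_image i setT x ->
    forall u : 'rV[R]_n, u != 0 -> 0 < bilin (gmx i x) u u;
  gmx_smooth : forall i (a b : 'I_n),
    smooth_on (chart_image i setT) (fun x => gmx i x a b);
  gmx_transition : forall i j x, chart_image i (dom j) x ->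
    gmx i x = jacobian (transition i j) x
                *m gmx j (transition i j x)
                *m (jacobian (transition i j) x)^T
}.

(** * Curvature of a metric on an open subset of R^n *)

Section Curvature.
Variables (R : realType) (n : nat) (G : 'rV[R]_n -> 'M[R]_n).
Implicit Types (a b c d : 'I_n) (x u v w z : 'rV[R]_n).

(* nabla_(d_a) d_b = \sum_c christoffel c a b *: d_c *)
Definition christoffel c a b : 'rV[R]_n -> R := fun x =>
  2^-1 * \sum_d invmx (G x) c d *
    (partial a (fun y => G y b d) x + partial b (fun y => G y a d) x
     - partial d (fun y => G y a b) x).

(* R(d_a, d_b) d_c = \sum_d curv_op d c a b *: d_d, where
   R(X, Y) Z = nabla_X nabla_Y Z - nabla_Y nabla_X Z - nabla_[X,Y] Z *)
Definition curv_op d c a b : 'rV[R]_n -> R := fun x =>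
  partial a (christoffel d b c) x - partial b (christoffel d a c) x
  + \sum_(m < n) (christoffel m b c x * christoffel d a m x
                  - christoffel m a c x * christoffel d b m x).

(* R(u, v; w, z) = g(R(u, v) z, w), so that R(u, v; u, v) is the sectional
   curvature of an orthonormal pair. *)
Definition riemann x u v w z : R :=
  \sum_a \sum_b \sum_c \sum_d u 0 a * v 0 b * w 0 c * z 0 d *
    \sum_m G x m c * curv_op m d a b x.

End Curvature.

(** * Conformal flatness *)

Definition conformal_gmx (R : realType) (n : nat) (M : smooth_manifold R n)
    (g : riemannian_metric M) (f : M -> R) (i : chart_index M) :
    'rV[R]_n -> 'M[R]_n :=
  fun x => expR (2 * f (chart_inv i x)) *: gmx g i x.

(* Every point has an open neighbourhood V with a smooth function f on V such
   that (V, e^(2f) g) is flat. *)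
Definition conformally_flat (R : realType) (n : nat) (M : smooth_manifold R n)
    (g : riemannian_metric M) : Prop :=
  forall p : M, exists (V : set M) (f : M -> R),
    [/\ open V, V p, smooth_fun_on V f &
        forall (i : chart_index M) (x : 'rV[R]_n), chart_image i V x ->
          forall u v w z, riemann (conformal_gmx g f i) x u v w z = 0].

(** * The exterior algebra of double forms on a Euclidean space *)

(* [om (I, J)] is the coefficient of e*_I (x) e*_J, where (e_i) is a fixed
   orthonormal basis and e*_I is the wedge product of the e*_i, i in I, in
   increasing order; a (p,q) double form has om (I, J) = 0 unless #|I| = p and
   #|J| = q. *)
Notation dform R n := {ffun {set 'I_n} * {set 'I_n} -> R}.

Section DoubleForms.
Variables (R : realType) (n : nat).
Implicit Types (om th : dform R n) (I J K L : {set 'I_n}).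

(* e*_I /\ e*_J = shuffle_sign I J *: e*_(I :|: J) for disjoint I and J *)
Definition shuffle_sign I J : R :=
  (-1) ^+ #|[pred ij : 'I_n * 'I_n |
               [&& ij.1 \in I, ij.2 \in J & (ij.2 < ij.1)%N]]|.

Definition dunit : dform R n :=
  [ffun IJ => (IJ == (finset.set0, finset.set0))%:R].

Definition dmul om th : dform R n :=
  [ffun IJ : {set 'I_n} * {set 'I_n} =>
     \sum_(K in powerset IJ.1) \sum_(L in powerset IJ.2)
       shuffle_sign K (IJ.1 :\: K) * shuffle_sign L (IJ.2 :\: L)
       * om (K, L) * th (IJ.1 :\: K, IJ.2 :\: L)].

Definition dpow om (k : nat) : dform R n := iter k (dmul om) dunit.

Definition dcontraction om : dform R n :=
  [ffun IJ : {set 'I_n} * {set 'I_n} =>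
     \sum_(i | (i \notin IJ.1) && (i \notin IJ.2))
       shuffle_sign [set i]%SET IJ.1 * shuffle_sign [set i]%SET IJ.2
       * om (i |: IJ.1, i |: IJ.2)%SET].

(* The Hodge star maps e*_K to shuffle_sign K (~: K) *: e*_(~: K). *)
Definition hodge om : dform R n :=
  [ffun IJ : {set 'I_n} * {set 'I_n} =>
     shuffle_sign (~: IJ.1) IJ.1 * shuffle_sign (~: IJ.2) IJ.2
     * om (~: IJ.1, ~: IJ.2)].

Definition dinner om th : R := \sum_IJ om IJ * th IJ.

(* the function identified with a (0,0) double form *)
Definition dscalar om : R := om (finset.set0, finset.set0).

Definition dform11 (h : 'I_n -> 'I_n -> R) : dform R n :=
  [ffun IJ => \sum_(i < n) \sum_(j < n | IJ == ([set i], [set j])%SET) h i j].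

Definition dform22 (r : 'I_n -> 'I_n -> 'I_n -> 'I_n -> R) : dform R n :=
  [ffun IJ => \sum_(i < n) \sum_(j : 'I_n | (i < j)%N)
              \sum_(k < n) \sum_(l : 'I_n | (k < l)%N
                              && (IJ == ([set i; j], [set k; l])%SET))
                r i j k l].

Definition dform11_mx om : 'M[R]_n :=
  \matrix_(i, j) om ([set i], [set j])%SET.

End DoubleForms.

(** * Elementary symmetric functions of eigenvalues *)

(* The eigenvalues, listed with multiplicity, of a matrix whose characteristic
   polynomial splits over R (in particular of a symmetric one). *)
Definition eigenvalues (R : realType) (n : nat) (S : 'M[R]_n) : seq R :=
  xget [::] [set s : seq R | char_poly S = \prod_(a <- s) ('X - a%:P)]%classic.

Definition elementary_symmetric (R : realType) (k : nat) (s : seq R) : R :=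
  \sum_(I : {set 'I_(size s)} | #|I| == k) \prod_(i in I) s`_i.

(** * Curvature invariants at a point *)

Record onframe (R : realType) (n : nat) (M : smooth_manifold R n)
    (g : riemannian_metric M) (p : M) := ONFrame {
  fchart : chart_index M;
  fchart_dom : dom fchart p;
  fvec : 'I_n -> 'rV[R]_n;
  fvec_orthonormal : forall i j,
    bilin (gmx g fchart (chart fchart p)) (fvec i) (fvec j) = (i == j)%:R
}.

Section Invariants.
Variables (R : realType) (n : nat) (M : smooth_manifold R n).
Variables (g : riemannian_metric M) (p : M).
Variable e : onframe g p.

Definition metric_form : dform R n :=
  dform11 (fun i j =>
    bilin (gmx g (fchart e) (chart (fchart e) p)) (fvec e i) (fvec e j)).

Definition riemann_form : dform R n :=
  dform22 (fun i j k l =>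
    riemann (gmx g (fchart e)) (chart (fchart e) p)
            (fvec e i) (fvec e j) (fvec e k) (fvec e l)).

Definition ricci_form : dform R n := dcontraction riemann_form.

Definition scal : R := dscalar (dcontraction ricci_form).

Definition schouten_form : dform R n :=
  (n%:R - 2)^-1 *: (ricci_form - (scal / (2 * (n%:R - 1))) *: metric_form).

Definition weyl_form : dform R n :=
  riemann_form - dmul metric_form schouten_form.

(* h_(2k) *)
Definition gauss_bonnet (k : nat) : R :=
  ((n - 2 * k)`!%:R)^-1
  * dscalar (hodge (dmul (dpow metric_form (n - 2 * k)) (dpow riemann_form k))).

(* As the basis is orthonormal, the eigenvalues of the matrix of A in it are the
   eigenvalues of A with respect to g. *)
Definition sigma (k : nat) : R :=
  elementary_symmetric k (eigenvalues (dform11_mx schouten_form)).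

End Invariants.

(* Main.v *)
Require Import Defs.
From HB Require Import structures.
From mathcomp Require Import all_boot all_order all_algebra.
From mathcomp Require Import all_classical all_reals all_analysis.
From mathcomp Require Import complex ring.

Set Implicit Arguments.
Unset Strict Implicit.
Unset Printing Implicit Defensive.

Import Order.TTheory GRing.Theory Num.Theory.
Import numFieldNormedType.Exports.

Local Open Scope ring_scope.

(** At a point, with an orthonormal frame, everything is algebra in the ring of
    double forms. The forms [g], [A], [W] and [Rm = W + g A] have equal degrees in
    both factors, and such forms commute ([balanced_comm]). The binomial theorem
    gives
      [g^(n-2k) Rm^k = \sum_i 'C(k, i) g^(n-2k+i) A^i W^(k-i)],
    and [h_(2k)] is, up to [(n-2k)!], the coefficient of this form on the volume
    element. That coefficient of a product [om th] is also the inner product of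
    [* om] with [th] ([dinner_hodge]), which produces the terms [i < k].

    The term [i = k] is [g^(n-k) A^k]. The top power of a bilinear form is [n!]
    times its determinant ([dpow_dform11_top], by Laplace expansion), so that the
    top power of [t g - A] is [n!] times the characteristic polynomial of [A];
    comparing the coefficients of the powers of [t] identifies [g^(n-k) A^k] with
    the elementary symmetric function of the eigenvalues
    ([elementary_symmetric_top]). For the eigenvalues to be real, [A] has to be
    symmetric, which rests on the pair symmetry of the curvature tensor: lowering
    the index in the coordinate formula of the curvature leaves second derivatives
    of the metric, which commute, and a symmetric quadratic form in the Christoffel
    symbols ([curv4E], [curv4_sym]).

    In the conformally flat case [W = 0], so that only the term [i = k] remains.
    Indeed the curvature of [e^(2f) g] is [e^(2f) (Rm - g K)] for a bilinear form
    [K] built from the second derivatives of [f] ([conformal_curv4]). If it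
    vanishes, then [Rm = g K], and contracting twice gives [A = K]
    ([schouten_kulkarni]). All the differential geometry takes place in the single
    chart of the frame. *)

(** * Shuffle signs and the algebra of double forms *)

Lemma big_disjointU (T : finType) (S : Type) (idx : S) (op : Monoid.com_law idx)
    (A B : {set T}) (F : T -> S) : [disjoint A & B] ->
  \big[op/idx]_(i in A :|: B) F i
  = op (\big[op/idx]_(i in A) F i) (\big[op/idx]_(i in B) F i).
Proof.
by move=> AB; rewrite -bigU //; apply: eq_bigl => i; rewrite !inE.
Qed.

Section ShuffleSign.
Variables (R : realType) (n : nat).
Implicit Types I J K L : {set 'I_n}.
Local Notation sg := (@shuffle_sign R n).

Lemma shuffle_signE I J :
  sg I J = \prod_(i in I) \prod_(j in J) (-1) ^+ (j < i)%N.
Proof.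
rewrite /shuffle_sign -sum1_card (eq_bigl (fun ij : 'I_n * 'I_n =>
  (ij.1 \in I) && ((ij.2 \in J) && (ij.2 < ij.1)%N))); last by move=> ij.
rewrite -(pair_big_dep (fun i => i \in I)
  (fun i j => (j \in J) && (j < i)%N) (fun _ _ => 1%N)) /=.
rewrite (big_morph _ (exprD _) (expr0 _)); apply: eq_bigr => i _.
rewrite (big_morph _ (exprD _) (expr0 _)) big_mkcondr /=.
by apply: eq_bigr => j _; case: ltnP.
Qed.

Lemma shuffle_signUl I J K : [disjoint I & J] ->
  sg (I :|: J) K = sg I K * sg J K.
Proof. by move=> IJ; rewrite !shuffle_signE big_disjointU. Qed.

Lemma shuffle_signUr I J K : [disjoint J & K] ->
  sg I (J :|: K) = sg I J * sg I K.
Proof.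
move=> JK; rewrite !shuffle_signE -big_split.
by apply: eq_bigr => i _; rewrite big_disjointU.
Qed.

Lemma shuffle_sign0l I : sg finset.set0 I = 1.
Proof. by rewrite shuffle_signE big_set0. Qed.

Lemma shuffle_sign0r I : sg I finset.set0 = 1.
Proof. by rewrite shuffle_signE big1 // => i _; rewrite big_set0. Qed.

Lemma shuffle_sign1l i J :
  sg [set i]%SET J = (-1) ^+ #|[pred j : 'I_n | (j \in J) && (j < i)%N]|.
Proof.
rewrite shuffle_signE big_set1 -sum1_card (big_morph _ (exprD _) (expr0 _)).
by rewrite [RHS]big_mkcondr; apply: eq_bigr => j _; case: ltnP.
Qed.

(** Every pair of [I * J] is an inversion of exactly one of the two shuffles. *)
Lemma shuffle_signC I J : [disjoint I & J] ->
  sg I J = (-1) ^+ (#|I| * #|J|) * sg J I.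
Proof.
move=> IJ; rewrite !shuffle_signE exchange_big /=.
have -> : (-1) ^+ (#|I| * #|J|) = \prod_(j in J) \prod_(i in I) (-1 : R).
  by under eq_bigr do rewrite prodr_const; rewrite prodr_const -exprM.
rewrite -big_split; apply: eq_bigr => j jJ; rewrite -big_split.
apply: eq_bigr => i iI /=; case: ltngtP => [||/val_inj ij].
- by rewrite mulr1.
- by rewrite mulrN1 opprK.
- by have := disjointFr IJ iI; rewrite -ij jJ.
Qed.

End ShuffleSign.

Section Wedge.
Variables (R : realType) (n : nat).
Implicit Types I J K L : {set 'I_n}.
Implicit Types X Y Z T : {set 'I_n} * {set 'I_n}.
Local Notation sg := (@shuffle_sign R n).

(** The structure constants of the exterior algebra in the basis e_I. Sums over
    all triples of index sets are easier to reassociate than the sums over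
    subsets in [dmul]. *)
Definition wedge_coef I J K : R :=
  if [disjoint I & J] && (I :|: J == K) then sg I J else 0.

Definition dwedge_coef X Y Z : R :=
  wedge_coef X.1 Y.1 Z.1 * wedge_coef X.2 Y.2 Z.2.

Lemma sum_powerset_wedge I (F : {set 'I_n} -> {set 'I_n} -> R) :
  \sum_(K in powerset I) sg K (I :\: K) * F K (I :\: K)
  = \sum_K \sum_L wedge_coef K L I * F K L.
Proof.
rewrite big_mkcond; apply: eq_bigr => K _; rewrite powersetE.
rewrite (bigD1 (I :\: K)) //= big1 ?addr0 => [|L LK]; rewrite /wedge_coef.
  rewrite disjoint_sym -setI_eq0 finset.setIDAC finset.setDIl.
  rewrite finset.setDv finset.setI0 eqxx /=.
  case: (boolP (K \subset I)) => [|KI].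
    by move=> /finset.setUidPr KI; rewrite finset.setDE finset.setUIr finset.setUCr
       finset.setIT KI eqxx.
  case: eqP => [KIE|]; last by rewrite mul0r.
  by rewrite -{1}KIE finset.subsetUl in KI.
case: ifP => [/andP[KL /eqP IE]|]; last by rewrite mul0r.
case/negP: LK; rewrite -IE finset.setDUl finset.setDv finset.set0U.
by rewrite eq_sym; apply/eqP/finset.setDidPl; rewrite disjoint_sym.
Qed.

Lemma dmulE (om th : dform R n) Z :
  dmul om th Z = \sum_X \sum_Y dwedge_coef X Y Z * (om X * th Y).
Proof.
case: Z => I J; rewrite ffunE /=.
pose G K K' := \sum_L \sum_L' wedge_coef L L' J * (om (K, L) * th (K', L')).
transitivity (\sum_K \sum_K' wedge_coef K K' I * G K K').
  rewrite -sum_powerset_wedge; apply: eq_bigr => K _.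
  rewrite /G -(sum_powerset_wedge J (fun L L' => om (K, L) * th (I :\: K, L'))).
  by rewrite mulr_sumr; apply: eq_bigr => L _; rewrite !mulrA.
transitivity (\sum_K \sum_L \sum_K' \sum_L'
    dwedge_coef (K, L) (K', L') (I, J) * (om (K, L) * th (K', L'))); last first.
  rewrite pair_bigA; apply: eq_bigr => -[K L] _ /=.
  by rewrite pair_bigA; apply: eq_bigr => -[K' L'] _.
apply: eq_bigr => K _.
rewrite exchange_big; apply: eq_bigr => K' _; rewrite mulr_sumr.
apply: eq_bigr => L _; rewrite mulr_sumr.
by apply: eq_bigr => L' _; rewrite mulrA.
Qed.

(** Both sums have a single term, and both terms shuffle the three index sets
    [I], [J], [K] into [L]. *)
Lemma wedge_coefA I J K L :
  \sum_P wedge_coef I P L * wedge_coef J K P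
  = \sum_P wedge_coef I J P * wedge_coef P K L.
Proof.
rewrite (bigD1 (J :|: K)) //= big1 ?addr0; last first.
  move=> P PJK; rewrite [wedge_coef J K P]/wedge_coef.
  by rewrite [_ == P]eq_sym (negPf PJK) andbF mulr0.
rewrite (bigD1 (I :|: J)) //= [in RHS]big1 ?addr0; last first.
  move=> P PJK; rewrite /wedge_coef.
  by rewrite [_ == P]eq_sym (negPf PJK) andbF mul0r.
rewrite /wedge_coef !eqxx !andbT finset.setUA -!setI_eq0.
rewrite finset.setIUl finset.setIUr !finset.setU_eq0.
case: (boolP (_ == L)) => _; rewrite ?andbF ?mulr0 ?mul0r // ?if_same ?mulr0 //.
rewrite !andbT.
case: (boolP (I :&: J == _)) => IJ; case: (boolP (J :&: K == _)) => JK;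
  rewrite /= ?andbF ?mulr0 ?mul0r //.
rewrite ?andbT; case: (boolP (I :&: K == _)) => IK; rewrite ?mul0r ?mulr0 //.
rewrite !setI_eq0 in IJ JK IK.
by rewrite shuffle_signUr // shuffle_signUl //; ring.
Qed.

(** The sum over pairs of index sets is a product of two sums, one for each
    factor of the double form. *)
Lemma dwedge_coefA X Y Z T :
  \sum_P dwedge_coef X P T * dwedge_coef Y Z P
  = \sum_P dwedge_coef X Y P * dwedge_coef P Z T.
Proof.
have sum_pair (F G : {set 'I_n} -> R) :
  \sum_P F P.1 * G P.2 = (\sum_I F I) * (\sum_J G J).
  rewrite mulr_suml; under [RHS]eq_bigr do rewrite mulr_sumr.
  by rewrite pair_bigA; apply: eq_bigr => -[I J] _.
rewrite /dwedge_coef; under eq_bigr do rewrite mulrACA.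
under [RHS]eq_bigr do rewrite mulrACA.
rewrite (sum_pair (fun I => wedge_coef X.1 I T.1 * wedge_coef Y.1 Z.1 I)
  (fun J => wedge_coef X.2 J T.2 * wedge_coef Y.2 Z.2 J)).
rewrite (sum_pair (fun I => wedge_coef X.1 Y.1 I * wedge_coef I Z.1 T.1)
  (fun J => wedge_coef X.2 Y.2 J * wedge_coef J Z.2 T.2)).
by rewrite !wedge_coefA.
Qed.

End Wedge.

Section DoubleFormRing.
Variables (R : realType) (n : nat).
Implicit Types om th ze : dform R n.

Lemma dmulA : associative (@dmul R n).
Proof.
move=> om th ze; apply/ffunP => T; rewrite !dmulE.
transitivity (\sum_X \sum_Y \sum_Z
  (\sum_P dwedge_coef R X P T * dwedge_coef R Y Z P) * (om X * th Y * ze Z)).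
  apply: eq_bigr => X _.
  transitivity (\sum_P \sum_Y \sum_Z dwedge_coef R X P T * dwedge_coef R Y Z P
     * (om X * th Y * ze Z)).
    apply: eq_bigr => P _; rewrite dmulE mulrA mulr_sumr.
    apply: eq_bigr => Y _; rewrite mulr_sumr; apply: eq_bigr => Z _.
    by ring.
  rewrite exchange_big; apply: eq_bigr => Y _.
  by rewrite exchange_big; apply: eq_bigr => Z _; rewrite mulr_suml.
under eq_bigr do under eq_bigr do under eq_bigr do rewrite dwedge_coefA.
symmetry.
transitivity (\sum_P \sum_Z \sum_X \sum_Y dwedge_coef R X Y P * dwedge_coef R P Z T
     * (om X * th Y * ze Z)).
  apply: eq_bigr => P _; apply: eq_bigr => Z _; rewrite dmulE mulrA mulrC mulr_sumr.
  rewrite mulr_sumr; apply: eq_bigr => X _; rewrite !mulr_sumr.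
  by apply: eq_bigr => Y _; ring.
rewrite exchange_big /=.
under eq_bigr do rewrite exchange_big /=.
rewrite exchange_big /=; apply: eq_bigr => X _.
under eq_bigr do rewrite exchange_big /=.
rewrite exchange_big /=; apply: eq_bigr => Y _.
by apply: eq_bigr => Z _; rewrite mulr_suml.
Qed.

Lemma dmul1l : left_id (dunit R n) (@dmul R n).
Proof.
move=> om; apply/ffunP => -[I J]; rewrite ffunE /=.
rewrite (bigD1 finset.set0) ?powersetE ?finset.sub0set //=.
rewrite [X in X + _](bigD1 finset.set0) ?powersetE ?finset.sub0set //=.
rewrite !finset.setD0 !shuffle_sign0l ffunE eqxx !mul1r.
rewrite !big1 ?addr0 // => [K /andP[_ K0]|K /andP[_ K0]].
  rewrite big1 // => L _; rewrite ffunE xpair_eqE (negPf K0) /=.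
  by rewrite mulr0 mul0r.
by rewrite ffunE xpair_eqE (negPf K0) andbF mulr0 mul0r.
Qed.

Lemma dmul1r : right_id (dunit R n) (@dmul R n).
Proof.
move=> om; apply/ffunP => -[I J]; rewrite ffunE /=.
have D0 (A B : {set 'I_n}) : B \in powerset A -> B != A ->
    (A :\: B == finset.set0) = false.
  rewrite powersetE => BA nBA; apply/negbTE; rewrite finset.setD_eq0.
  by apply: contra nBA => AB; rewrite finset.eqEsubset BA.
rewrite (bigD1 I) ?powersetE //=.
rewrite [X in X + _](bigD1 J) ?powersetE //=.
rewrite !finset.setDv !shuffle_sign0r ffunE eqxx !mulr1 !mul1r.
rewrite !big1 ?addr0 // => [K /andP[KI K0]|K /andP[KJ K0]].
  by rewrite big1 // => L _; rewrite ffunE xpair_eqE D0 //= mulr0.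
by rewrite ffunE xpair_eqE (D0 J) // andbF mulr0.
Qed.

Lemma dmulDl : left_distributive (@dmul R n) +%R.
Proof.
move=> om th ze; apply/ffunP => T; rewrite [RHS]ffunE !dmulE -big_split.
apply: eq_bigr => X _; rewrite -big_split; apply: eq_bigr => Y _.
by rewrite ffunE /= mulrDl mulrDr.
Qed.

Lemma dmulDr : right_distributive (@dmul R n) +%R.
Proof.
move=> om th ze; apply/ffunP => T; rewrite [RHS]ffunE !dmulE -big_split.
apply: eq_bigr => X _; rewrite -big_split; apply: eq_bigr => Y _.
by rewrite ffunE /= !mulrDr.
Qed.

Lemma dmul_scalel (a : R) om th : dmul (a *: om) th = a *: dmul om th.
Proof.
apply/ffunP => T; rewrite [RHS]ffunE !dmulE scaler_sumr.
apply: eq_bigr => X _; rewrite scaler_sumr; apply: eq_bigr => Y _.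
by rewrite ffunE /GRing.scale /=; ring.
Qed.

Lemma dmul_scaler (a : R) om th : dmul om (a *: th) = a *: dmul om th.
Proof.
apply/ffunP => T; rewrite [RHS]ffunE !dmulE scaler_sumr.
apply: eq_bigr => X _; rewrite scaler_sumr; apply: eq_bigr => Y _.
by rewrite ffunE /GRing.scale /=; ring.
Qed.

(** The pointwise product makes [dform] a ring in a second way; the exterior
    product therefore lives on a copy of the type. *)
Definition dalg : Type := dform R n.

HB.instance Definition _ := GRing.Zmodule.on dalg.
HB.instance Definition _ := GRing.Zmodule_isPzRing.Build dalg
  dmulA dmul1l dmul1r dmulDl dmulDr.

Lemma dalg_mulE (om th : dalg) : om * th = dmul om th.
Proof. by []. Qed.

Lemma dform_scaleE (a : R) om X : (a *: om) X = a * om X.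
Proof. by rewrite ffunE. Qed.

Lemma dpowE om k : dpow om k = (om : dalg) ^+ k.
Proof. by elim: k => //= k IHk; rewrite exprS -IHk. Qed.

Lemma dpowZ (a : R) om k : dpow (a *: om) k = a ^+ k *: dpow om k.
Proof.
elim: k => [|k IHk] /=; first by rewrite expr0 scale1r.
by rewrite IHk dmul_scalel dmul_scaler scalerA -exprS.
Qed.

(** The span of the [(p, p)] double forms, where the exterior product is
    commutative. *)
Definition balanced om := forall I J, om (I, J) != 0 -> #|I| = #|J|.

(** Both factors pick up the same sign, because their degrees agree. *)
Lemma balanced_comm om th : balanced om -> balanced th ->
  GRing.comm (om : dalg) (th : dalg).
Proof.
move=> omB thB; apply/ffunP => T; rewrite [LHS]dmulE [RHS]dmulE exchange_big /=.
apply: eq_bigr => Y _; apply: eq_bigr => X _; rewrite [om _ * _]mulrC.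
case: (eqVneq (om X) 0) => [->|oX]; first by rewrite !mulr0.
case: (eqVneq (th Y) 0) => [->|tY]; first by rewrite !mul0r !mulr0.
congr (_ * _); move: oX tY; case: X Y => [I J] [K L] /omB IJ /thB KL.
rewrite /dwedge_coef /wedge_coef /= ![K :|: _]finset.setUC ![L :|: _]finset.setUC.
rewrite ![[disjoint K & _]]disjoint_sym ![[disjoint L & _]]disjoint_sym.
case: ifP => [/andP[IK _]|]; last by rewrite !mul0r.
case: ifP => [/andP[JL _]|]; last by rewrite !mulr0.
rewrite (shuffle_signC _ IK) (shuffle_signC _ JL) IJ KL mulrACA -exprD addnn.
by rewrite -signr_odd odd_double mul1r.
Qed.

End DoubleFormRing.

(** * Top powers of bilinear forms *)

Section TopCoefficient.
Variables (R : realType) (n : nat).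
Implicit Types (om th : dform R n) (I J K L : {set 'I_n}).

Lemma dscalar_hodge om : dscalar (hodge om) = om ([set: 'I_n]%SET, [set: 'I_n]%SET).
Proof.
by rewrite /dscalar ffunE /= !finset.setC0 !shuffle_sign0r !mul1r.
Qed.

(** The Hodge operator complements the index sets and carries exactly the signs
    of the product, so that both sides are the same sum over pairs of index sets,
    one indexed by the complements of the other. *)
Lemma dinner_hodge om th :
  dinner (hodge om) th = dmul om th ([set: 'I_n]%SET, [set: 'I_n]%SET).
Proof.
rewrite /dinner [RHS]ffunE /= [RHS](eq_bigl xpredT) => [|K]; last first.
  by rewrite powersetE finset.subsetT.
transitivity (\sum_I \sum_J hodge om (I, J) * th (I, J)).
  by rewrite pair_bigA; apply: eq_bigr => -[I J] _.
rewrite (reindex_inj (@finset.setC_inj _)); apply: eq_bigr => I _.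
rewrite [RHS](eq_bigl xpredT) => [|K]; last by rewrite powersetE finset.subsetT.
rewrite (reindex_inj (@finset.setC_inj _)); apply: eq_bigr => J _.
by rewrite ffunE /= !finset.setCK !finset.setTD.
Qed.

Lemma dform11E (h : 'I_n -> 'I_n -> R) I J :
  dform11 h (I, J)
  = ((#|I| == 1%N) && (#|J| == 1%N))%:R * \sum_(i in I) \sum_(j in J) h i j.
Proof.
rewrite ffunE; case: (boolP (_ && _)) => [/andP[/cards1P[a ->] /cards1P[b ->]]|IJ].
  rewrite mul1r !big_set1 (bigD1 a) //= (bigD1 b) ?eqxx //=.
  rewrite big1 ?addr0 => [|j /andP[]]; last first.
    by rewrite xpair_eqE eqxx /= => /eqP/finset.set1_inj ->; rewrite eqxx.
  rewrite big1 ?addr0 // => i ia; apply: big1 => j.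
  by rewrite xpair_eqE => /andP[/eqP/finset.set1_inj ai]; rewrite ai eqxx in ia.
rewrite mul0r; apply: big1 => i _; apply: big1 => j.
by rewrite xpair_eqE => /andP[/eqP Ii /eqP Jj]; rewrite Ii Jj !cards1 in IJ.
Qed.

Lemma dform11_balanced h : balanced (dform11 h : dform R n).
Proof.
move=> I J; rewrite dform11E; case: (#|I| =P 1%N) => [->|_]; last by rewrite mul0r eqxx.
by case: (#|J| =P 1%N) => [->|_] //; rewrite mul0r eqxx.
Qed.

Lemma dmul_dform11 h th I J : dmul (dform11 h) th (I, J)
  = \sum_(i in I) \sum_(j in J)
      shuffle_sign R [set i]%SET (I :\ i) * shuffle_sign R [set j]%SET (J :\ j)
      * h i j * th (I :\ i, J :\ j).
Proof.
rewrite ffunE /= (bigID (mem [set [set i]%SET | i in I]%SET)) /=.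
rewrite [X in _ + X]big1 ?addr0 => [|K /andP[KI /imsetP Ki]]; last first.
  apply: big1 => L LJ; rewrite dform11E.
  case: (boolP (#|K| == 1%N)) => [/cards1P[i KE]|]; last by rewrite mul0r mulr0 mul0r.
  case: Ki; exists i => //; rewrite powersetE KE finset.sub1set in KI; exact: KI.
rewrite (eq_bigl (mem [set [set i]%SET | i in I]%SET)) => [|K]; last first.
  rewrite /= andbC; case: imsetP => //= -[i iI ->].
  by rewrite powersetE finset.sub1set iI.
rewrite big_imset /= => [|i j _ _ /finset.set1_inj //].
apply: eq_bigr => i iI.
rewrite (bigID (mem [set [set j]%SET | j in J]%SET)) /=.
rewrite [X in _ + X]big1 ?addr0 => [|L /andP[LJ /imsetP Lj]]; last first.
  rewrite dform11E cards1 eqxx.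
  case: (boolP (#|L| == 1%N)) => [/cards1P[j LE]|]; last by rewrite mul0r mulr0 mul0r.
  case: Lj; exists j => //; rewrite powersetE LE finset.sub1set in LJ; exact: LJ.
rewrite (eq_bigl (mem [set [set j]%SET | j in J]%SET)) => [|L]; last first.
  rewrite /= andbC; case: imsetP => //= -[j jJ ->].
  by rewrite powersetE finset.sub1set jJ.
rewrite big_imset /= => [|? ? _ _ /finset.set1_inj //].
by apply: eq_bigr => j jJ; rewrite dform11E !cards1 !big_set1 mul1r.
Qed.

End TopCoefficient.

Section Pullback.
Variables (R : realType) (m n : nat) (f f' : 'I_m -> 'I_n).
Hypothesis f_mono : {mono f : i j / (i < j)%N}.
Hypothesis f'_mono : {mono f' : i j / (i < j)%N}.

Let mono_inj (p : 'I_m -> 'I_n) : {mono p : i j / (i < j)%N} -> injective p.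
Proof.
move=> pm i j pij; have := pm j i; have := pm i j; rewrite pij ltnn.
by case: ltngtP => // /val_inj.
Qed.

Lemma shuffle_sign_imset (p : 'I_m -> 'I_n) (I J : {set 'I_m}) :
  {mono p : i j / (i < j)%N} ->
  shuffle_sign R (p @: I) (p @: J) = shuffle_sign R I J.
Proof.
move=> pm; rewrite !shuffle_signE big_imset /= => [|? ? _ _ /(mono_inj pm) //].
apply: eq_bigr => i _; rewrite big_imset /= => [|? ? _ _ /(mono_inj pm) //].
by apply: eq_bigr => j _; rewrite pm.
Qed.

Let powerset_imset (p : 'I_m -> 'I_n) (I : {set 'I_m}) : injective p ->
  powerset (p @: I) = [set p @: K | K : {set 'I_m} in powerset I]%SET.
Proof.
move=> pinj; apply/setP => L; rewrite powersetE; apply/idP/imsetP; last first.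
  by case=> K; rewrite powersetE => KI ->; apply: imsetS.
move=> LI; exists (p @^-1: L); last first.
  apply/eqP; rewrite finset.eqEsubset; apply/andP; split; last first.
    by apply/fintype.subsetP => _ /imsetP[k + ->]; rewrite inE.
  apply/fintype.subsetP => l lL; have /imsetP[k kI lk] := fintype.subsetP LI l lL.
  by rewrite lk imset_f // inE -lk.
rewrite powersetE; apply/fintype.subsetP => k; rewrite inE => /(fintype.subsetP LI).
by case/imsetP => k' k'I /pinj ->.
Qed.

(** The restriction to coordinate subspaces embedded by increasing maps, which
    preserve the shuffle signs; it is an algebra morphism. *)
Definition dpullback (om : dform R n) : dform R m :=
  [ffun IJ => om (f @: (IJ.1 : {set _}), f' @: (IJ.2 : {set _}))].

Lemma dpullback_mul om th :
  dpullback (dmul om th) = dmul (dpullback om) (dpullback th).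
Proof.
apply/ffunP => -[I J]; rewrite !ffunE /=.
rewrite (powerset_imset _ (mono_inj f_mono)) big_imset /=; last first.
  by move=> ? ? _ _; apply: imset_inj; exact: mono_inj.
apply: eq_bigr => K KI.
rewrite (powerset_imset _ (mono_inj f'_mono)) big_imset /=; last first.
  by move=> ? ? _ _; apply: imset_inj; exact: mono_inj.
apply: eq_bigr => L LJ.
have D (p : 'I_m -> 'I_n) (A B : {set 'I_m}) : injective p ->
    p @: A :\: p @: B = p @: (A :\: B).
  move=> pi; apply/setP => x; rewrite inE; apply/andP/imsetP.
    case=> xB /imsetP[a aA xa]; exists a => //; rewrite inE aA andbT.
    by apply: contra xB; rewrite xa; exact: imset_f.
  case=> a; rewrite inE => /andP[aB aA] ->; split; last exact: imset_f.
  by rewrite mem_imset.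
rewrite !D; [|exact: mono_inj..].
by rewrite !ffunE /= !shuffle_sign_imset.
Qed.

Lemma dpullback_pow om k : dpullback (dpow om k) = dpow (dpullback om) k.
Proof.
elim: k => [|k IHk] /=; last by rewrite dpullback_mul IHk.
by apply/ffunP => -[I J]; rewrite !ffunE /= !xpair_eqE !imset_eq0.
Qed.

Lemma dpullback_dform11 h :
  dpullback (dform11 h) = dform11 (fun i j => h (f i) (f' j)).
Proof.
apply/ffunP => -[I J]; rewrite ffunE /= !dform11E.
rewrite !card_imset; [|exact: mono_inj..]; congr (_ * _).
rewrite big_imset /= => [|? ? _ _ /(mono_inj f_mono) //].
apply: eq_bigr => i _.
by rewrite big_imset /= => [|? ? _ _ /(mono_inj f'_mono) //].
Qed.

End Pullback.

Lemma lift_mono n (i : 'I_n) : {mono lift i : j k / (j < k)%N}.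
Proof.
by move=> j k; rewrite /= !ltnNge leq_bump2.
Qed.

Lemma setT_lift n (i : 'I_n.+1) :
  [set: 'I_n.+1]%SET :\ i = lift i @: [set: 'I_n]%SET.
Proof.
apply/setP => j; rewrite !inE andbT; apply/idP/imsetP => [ji|[k _ ->]].
  by rewrite eq_sym in ji; have [k ->] := unlift_some ji; exists k; rewrite ?inE.
by rewrite eq_sym neq_lift.
Qed.

Lemma shuffle_sign_setT (R : realType) n (i : 'I_n) :
  shuffle_sign R [set i]%SET ([set: 'I_n]%SET :\ i) = (-1) ^+ i.
Proof.
rewrite shuffle_sign1l; congr (_ ^+ _).
rewrite (@eq_card _ _ [pred j : 'I_n | (j < i)%N]) => [|j].
  rewrite -sum1_card -(big_ord_widen n (fun=> 1%N) (ltnW (ltn_ord i))).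
  by rewrite sum1_card card_ord.
by rewrite !inE andbT; case: (ltnP j i) => ji; rewrite ?andbF // andbT neq_ltn ji.
Qed.

(** The [n]-th exterior power of a bilinear form is [n!] times its determinant:
    splitting off one factor and restricting the remaining ones to coordinate
    hyperplanes is the Laplace expansion, once for each of the [n] rows. *)
Lemma dpow_dform11_top (R : realType) n (h : 'I_n -> 'I_n -> R) :
  dpow (dform11 h) n ([set: 'I_n]%SET, [set: 'I_n]%SET)
  = n`!%:R * \det (\matrix_(i, j) h i j).
Proof.
elim: n h => [|n IHn] h.
  have -> : [set: 'I_0]%SET = finset.set0 by apply/setP => -[].
  by rewrite /= ffunE eqxx det_mx00 fact0 mulr1.
rewrite /= dmul_dform11.
transitivity (\sum_(i < n.+1) n`!%:R * \det (\matrix_(i, j) h i j)); last first.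
  by rewrite sumr_const card_ord factS natrM -[RHS]mulrA [RHS]mulr_natl.
apply: eq_big => [i|i _]; first by rewrite inE.
rewrite (expand_det_row _ i) mulr_sumr.
apply: eq_big => [j|j _]; first by rewrite inE.
rewrite !shuffle_sign_setT !setT_lift.
have := dpullback_pow (@lift_mono _ i) (@lift_mono _ j) (dform11 h) n.
move=> /ffunP/(_ ([set: 'I_n]%SET, [set: 'I_n]%SET)); rewrite ffunE /= => ->.
rewrite (dpullback_dform11 (@lift_mono _ i) (@lift_mono _ j)).
rewrite IHn /cofactor mxE exprD.
suff -> : row' i (col' j (\matrix_(i, j) h i j)) =
   \matrix_(a, b) h (lift i a) (lift j b) by ring.
by apply/matrixP => a b; rewrite !mxE.
Qed.

(** * Elementary symmetric functions and the binomial expansion *)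

(** For an eigenvector [v] with adjoint [w], both [v B w = z (v w)] and
    [v w > 0] are self-conjugate, hence so is [z]. *)
Lemma hermitian_root_real (C : numClosedFieldType) n (B : 'M[C]_n) (z : C) :
  (map_mx Num.conj B)^T = B -> root (char_poly B) z -> z \is Num.real.
Proof.
move=> BT zr; apply/CrealP.
have /eigenvalueP[v vB v0] : eigenvalue B z by rewrite eigenvalue_root_char.
pose adj (u : 'rV[C]_n) := (map_mx Num.conj u)^T.
have vw : (v *m adj v) 0 0 != 0.
  apply: contra_neq v0; rewrite !mxE.
  under eq_bigr do rewrite !mxE -normCK.
  move=> /eqP; rewrite psumr_eq0 => [/allP vi|? _]; last exact: exprn_ge0.
  apply/rowP => i; rewrite mxE; apply/eqP.
  by have := vi i (mem_index_enum i); rewrite sqrf_eq0 normr_eq0.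
have adjP (u u' : 'rV[C]_n) : ((u *m adj u') 0 0)^* = (u' *m adj u) 0 0.
  rewrite !mxE rmorph_sum; apply: eq_bigr => k _.
  by rewrite !mxE rmorphM /= conjCK mulrC.
have adjB (u : 'rV[C]_n) : adj (u *m B) = B *m adj u.
  by rewrite /adj map_mxM trmx_mul BT.
have vBv : (v *m B *m adj v) 0 0 = z * (v *m adj v) 0 0.
  by rewrite vB -scalemxAl mxE.
apply: (mulIf vw); rewrite -vBv -{1}(adjP v v) -rmorphM /= -vBv adjP adjB.
by rewrite mulmxA.
Qed.

(** The characteristic polynomial splits over the complex numbers, and its roots
    are real because the matrix is hermitian there. *)
Lemma symmetric_char_poly_splits (R : realType) n (A : 'M[R]_n) : A^T = A ->
  exists s : seq R, char_poly A = \prod_(a <- s) ('X - a%:P).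
Proof.
move=> AT; pose B : 'M[R[i]]_n := map_mx (real_complex R) A.
have [r rE] := closed_field_poly_normal (char_poly B).
have /monicP lcB := char_poly_monic B; rewrite lcB scale1r in rE.
have real z : z \in r -> real_complex R (complex.Re z) = z.
  move=> zr; apply: RRe_real; apply: (@hermitian_root_real _ _ B).
    apply/matrixP => i j; rewrite !mxE -[in LHS]AT mxE.
    exact: conjc_real.
  by rewrite rE root_prod_XsubC.
exists [seq complex.Re z | z <- r].
apply: (map_poly_inj (real_complex R)).
rewrite map_char_poly rE rmorph_prod big_map.
rewrite !big_seq; apply: eq_bigr => z zr.
by rewrite rmorphB /= map_polyX map_polyC /= real.
Qed.

Lemma poly_horner_inj (R : realType) (p q : {poly R}) :
  (forall t, p.[t] = q.[t]) -> p = q.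
Proof.
move=> pq; apply/eqP; rewrite -subr_eq0; apply/negPn/negP => pq0.
(* One more root than the degree of [p - q] allows. *)
pose rs : seq R := [seq i%:R | i <- iota 0 (size (p - q))].
have rs_root : all (root (p - q)) rs.
  by apply/allP => t _; rewrite rootE !hornerE pq subrr.
have rs_uniq : uniq rs.
  by rewrite map_inj_uniq ?iota_uniq // => i j /eqP; rewrite eqr_nat => /eqP.
by have := max_poly_roots pq0 rs_root rs_uniq; rewrite size_map size_iota ltnn.
Qed.

Section ElementarySymmetric.
Variables (R : realType) (n : nat) (a : 'I_n -> 'I_n -> R).

Let g : dform R n := dform11 (fun i j => (i == j)%:R).
Let A := dform11 a.

Let top (om : dform R n) := om ([set: 'I_n]%SET, [set: 'I_n]%SET).

(** [t g - A] is the bilinear form of the matrix [t - A], whose top power is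
    [n!] times its determinant. *)
Lemma dform11_char_poly_top t :
  top (dpow (t *: g - A) n) = n`!%:R * (char_poly (\matrix_(i, j) a i j)).[t].
Proof.
have -> : t *: g - A = dform11 (fun i j => t * (i == j)%:R - a i j).
  apply/ffunP => -[I J]; rewrite !ffunE /GRing.scale /= mulr_sumr -sumrB.
  apply: eq_bigr => i _; rewrite mulr_sumr -sumrB; apply: eq_bigr => j _.
  by [].
rewrite /top dpow_dform11_top; congr (_ * _).
rewrite /char_poly -horner_evalE -det_map_mx; congr (\det _).
apply/matrixP => i j; rewrite !mxE /= horner_evalE !hornerE.
by case: eqP; rewrite ?mulr1n ?mulr0n /= ?hornerE ?mulr1 ?mulr0.
Qed.

Lemma dform11_comm (h h' : 'I_n -> 'I_n -> R) :
  GRing.comm (dform11 h : dalg R n) (dform11 h' : dalg R n).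
Proof. by apply: balanced_comm; exact: dform11_balanced. Qed.

Lemma top_dpow_sub t : top (dpow (t *: g - A) n) =
  \sum_(i < n.+1) t ^+ (n - i) * ((-1) ^+ i * 'C(n, i)%:R
                     * top (dmul (dpow g (n - i)) (dpow A i))).
Proof.
have cgA : GRing.comm (t *: g : dalg R n) (-1 *: A : dalg R n).
  rewrite /GRing.comm !dalg_mulE !dmul_scalel !dmul_scaler scalerA mulrC -scalerA.
  by congr (_ *: (_ *: _)); exact: dform11_comm.
rewrite -scaleN1r dpowE (exprDn_comm _ cgA) /top sum_ffunE; apply: eq_bigr => i _.
rewrite ffunMnE -!dpowE !dpowZ dalg_mulE dmul_scalel dmul_scaler !dform_scaleE.
by rewrite -mulr_natr; ring.
Qed.

(** The coefficient of [t ^ (n - k)] in the top power of [t g - A] is computed in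
    two ways, by the binomial theorem and as [n!] times the coefficient of the
    characteristic polynomial. The symmetry of the matrix makes its
    eigenvalues exist in [R]. *)
Lemma elementary_symmetric_top k : (k <= n)%N ->
  (\matrix_(i, j) a i j)^T = \matrix_(i, j) a i j ->
  top (dmul (dpow g (n - k)) (dpow A k))
  = (n - k)`!%:R * k`!%:R
    * elementary_symmetric k (eigenvalues (\matrix_(i, j) a i j)).
Proof.
move=> kn aT; set S := \matrix_(i, j) a i j.
have SE : char_poly S = \prod_(x <- eigenvalues S) ('X - x%:P).
  rewrite /eigenvalues; case: xgetP => [s _ //|/= no].
  by have [s sE] := symmetric_char_poly_splits aT; case: (no s).
have sz : size (eigenvalues S) = n.
  by have := size_char_poly S; rewrite SE size_prod_XsubC => -[].
have coefS : (char_poly S)`_(n - k) = (-1) ^+ k * elementary_symmetric k (eigenvalues S).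
  rewrite SE; move: (eigenvalues S) sz => s sz.
  rewrite -sz in kn *; rewrite coef_prod_XsubC ?leq_subr // subKn //.
pose P := \poly_(j < n.+1) ((-1) ^+ (n - j) * 'C(n, n - j)%:R
                     * top (dmul (dpow g j) (dpow A (n - j)))).
have PE : n`!%:R *: char_poly S = P.
  apply: poly_horner_inj => t; rewrite hornerZ -dform11_char_poly_top top_dpow_sub.
  rewrite horner_poly (reindex_inj rev_ord_inj); apply: eq_bigr => i _ /=.
  have iN : (i <= n)%N by rewrite -ltnS.
  by rewrite subKn // mulrC.
have := congr1 (fun p : {poly R} => p`_(n - k)) PE.
rewrite coefZ coefS coef_poly ltnS leq_subr subKn // -(bin_fact kn) !natrM.
have C0 : ('C(n, k)%:R : R) != 0 by rewrite pnatr_eq0 -lt0n bin_gt0.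
move=> eq_coef; apply: (mulfI C0); apply: (mulfI (negbT (signr_eq0 R k))).
by rewrite mulrA -eq_coef; ring.
Qed.

End ElementarySymmetric.

(** The binomial theorem: [g], [A] and [W + g A] commute as balanced forms, and
    therefore so do [g], [A] and [W]. *)
Lemma top_pow_decomposition (R : realType) n (g A W : dform R n) m k :
  balanced g -> balanced A -> balanced (W + dmul g A) ->
  dmul (dpow g m) (dpow (W + dmul g A) k)
  = \sum_(i < k.+1) dmul (dmul (dpow g (m + i)) (dpow A i)) (dpow W (k - i))
                    *+ 'C(k, i).
Proof.
move=> gB AB RB; have cgA := balanced_comm gB AB.
have cg : GRing.comm (g : dalg R n) (W : dalg R n).
  have := commrB (balanced_comm gB RB) (commrM (commr_refl _) cgA).
  by rewrite -dalg_mulE addrK.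
have cA : GRing.comm (A : dalg R n) (W : dalg R n).
  have := commrB (balanced_comm AB RB) (commrM (commr_sym cgA) (commr_refl _)).
  by rewrite -dalg_mulE addrK.
rewrite !dpowE -!dalg_mulE.
have cW : GRing.comm (W : dalg R n) ((g : dalg R n) * (A : dalg R n)).
  by apply: commrM; exact: commr_sym.
rewrite (exprDn_comm _ cW) mulr_sumr; apply: eq_bigr => i _.
rewrite -!dalg_mulE !dpowE mulrnAr exprMn_comm // exprD -!mulrA.
have cWi : GRing.comm ((W : dalg R n) ^+ (k - i))
    ((g : dalg R n) ^+ i * (A : dalg R n) ^+ i).
  apply/commr_sym/commrX/commr_sym.
  by apply: commrM; apply: commrX; exact: commr_sym.
by rewrite cWi -mulrA.
Qed.

(** * Curvature forms and their contraction *)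

Section CurvatureForms.
Variables (R : realType) (n : nat).
Implicit Types (i j k l a b : 'I_n) (I J : {set 'I_n}).
Implicit Types (om : dform R n) (r : 'I_n -> 'I_n -> 'I_n -> 'I_n -> R).

Lemma set2_ltn_inj i j a b : (i < j)%N -> (a < b)%N ->
  ([set i; j]%SET == [set a; b]%SET) = ((i == a) && (j == b)).
Proof.
move=> ij ab; apply/eqP/andP => [/setP E|[/eqP-> /eqP->] //].
have := E i; have := E j; rewrite !inE !eqxx ?orbT /=.
move=> /esym/orP[] /eqP ja /esym/orP[] /eqP ia; subst; rewrite ?eqxx //.
- by rewrite ltnn in ij.
- by have := ltn_trans ij ab; rewrite ltnn.
- by rewrite ltnn in ij.
Qed.

Lemma card2_ltnP I : #|I| = 2 -> exists i j, (i < j)%N /\ I = [set i; j]%SET.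
Proof.
move=> /eqP/cards2P[i [j [ij ->]]]; have [lt|lt|/val_inj eqij] := ltngtP i j.
- by exists i, j; split.
- by exists j, i; split=> //; exact: finset.setUC.
- by rewrite eqij eqxx in ij.
Qed.

Let sum_ltn_set2 a b (F : 'I_n -> 'I_n -> R) : (a < b)%N ->
  \sum_(i < n) \sum_(j : 'I_n | (i < j)%N)
    (if [set a; b]%SET == [set i; j]%SET then F i j else 0) = F a b.
Proof.
move=> ab; rewrite (bigD1 a) //= (bigD1 b) //= eqxx !big1 ?addr0 // => [i ia|j].
  by apply: big1 => j ij; rewrite set2_ltn_inj // [a == i]eq_sym (negPf ia).
by case/andP=> aj jb; rewrite set2_ltn_inj // [b == j]eq_sym (negPf jb) andbF.
Qed.

Lemma dform22E r i j k l : (i < j)%N -> (k < l)%N ->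
  dform22 r ([set i; j]%SET, [set k; l]%SET) = r i j k l.
Proof.
move=> ij kl; rewrite ffunE -(sum_ltn_set2 (fun i j => r i j k l) ij).
apply: eq_bigr => i' _; apply: eq_bigr => j' ij'.
case: ifP => [E|E]; last first.
  by apply: big1 => k' _; apply: big1 => l'; rewrite xpair_eqE E /= andbF.
rewrite -(sum_ltn_set2 (fun k l => r i' j' k l) kl).
apply: eq_bigr => k' _; rewrite big_mkcondr; apply: eq_bigr => l' _.
by rewrite xpair_eqE E.
Qed.

Lemma dform22_out r I J : dform22 r (I, J) != 0 -> #|I| = 2 /\ #|J| = 2.
Proof.
rewrite ffunE => nz; suff : (#|I| == 2) && (#|J| == 2) by case/andP=> /eqP-> /eqP->.
apply: contraNT nz => IJ; apply/eqP.
apply: big1 => i _; apply: big1 => j ij; apply: big1 => k _; apply: big1 => l.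
case/andP=> kl; rewrite xpair_eqE => /andP[/eqP IE /eqP JE].
by rewrite IE JE !cards2 !neq_ltn ij kl in IJ.
Qed.

Lemma dform22_balanced r : balanced (dform22 r).
Proof. by move=> I J /dform22_out[-> ->]. Qed.

(** Components with increasing indices suffice, since a set of two indices has a
    unique increasing enumeration. *)
Lemma dform22_ext om r :
  (forall I J, om (I, J) != 0 -> #|I| = 2 /\ #|J| = 2) ->
  (forall i j k l, (i < j)%N -> (k < l)%N ->
     om ([set i; j]%SET, [set k; l]%SET) = r i j k l) ->
  om = dform22 r.
Proof.
move=> om_out omE; apply/ffunP => -[I J].
have [/andP[/eqP I2 /eqP J2]|IJ] := boolP ((#|I| == 2) && (#|J| == 2)).
  have [i [j [ij ->]]] := card2_ltnP I2; have [k [l [kl ->]]] := card2_ltnP J2.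
  by rewrite omE // dform22E.
transitivity (0 : R); first apply/eqP; last apply/esym/eqP.
  by apply: contraNT IJ => /om_out[-> ->].
by apply: contraNT IJ => /dform22_out[-> ->].
Qed.

Lemma dform22_sym r I J : (forall i j k l, r i j k l = r k l i j) ->
  dform22 r (I, J) = dform22 r (J, I).
Proof.
move=> rS; pose om : dform R n := [ffun IJ => dform22 r (IJ.2, IJ.1)].
have omE : om = dform22 r.
  apply: dform22_ext => [K L|i j k l ij kl]; rewrite ffunE /=.
    by case/dform22_out.
  by rewrite dform22E.
by rewrite -{1}omE ffunE.
Qed.

Lemma dcontraction_sym om I J : (forall K L, om (K, L) = om (L, K)) ->
  dcontraction om (I, J) = dcontraction om (J, I).
Proof.
move=> omS; rewrite !ffunE /=; apply: eq_big => [i|i _]; first by rewrite andbC.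
by rewrite omS [shuffle_sign _ _ _ * _]mulrC.
Qed.

(** The contraction in terms of components: the terms with a repeated index
    vanish and the two shuffle signs sort the indices. *)
Lemma dcontraction_dform22 r :
  (forall i j k l, r j i k l = - r i j k l) ->
  (forall i j k l, r i j l k = - r i j k l) ->
  dcontraction (dform22 r) = dform11 (fun j l => \sum_i r i j i l).
Proof.
move=> r1 r2.
have r0 i k l : r i i k l = 0.
  by apply/eqP; rewrite -[_ == 0](mulrn_eq0 _ 2) mulr2n {1}r1 addNr.
have r0' i j k : r i j k k = 0.
  by apply/eqP; rewrite -[_ == 0](mulrn_eq0 _ 2) mulr2n {1}r2 addNr.
have srt i j k l : i != j -> k != l -> dform22 r ([set i; j]%SET, [set k; l]%SET)
    = (-1) ^+ (j < i)%N * (-1) ^+ (l < k)%N * r i j k l.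
  have half i' j' k' l' : (i' < j')%N -> k' != l' ->
     dform22 r ([set i'; j']%SET, [set k'; l']%SET)
    = (-1) ^+ (l' < k')%N * r i' j' k' l'.
    move=> ij; case: (ltngtP k' l') => [kl _|kl _|/val_inj -> /eqP//].
      by rewrite dform22E // mul1r.
    by rewrite [[set k'; _]%SET]finset.setUC dform22E // r2 mulN1r.
  case: (ltngtP i j) => [ij _ kl|ij _ kl|/val_inj -> /eqP//].
    by rewrite half // mul1r.
  by rewrite [[set i; _]%SET]finset.setUC half // r1 expr1; ring.
apply/ffunP => -[I J]; rewrite dform11E ffunE /=.
have [/andP[/cards1P[j ->] /cards1P[l ->]]|IJ] := boolP (_ && _); last first.
  rewrite mul0r; apply: big1 => i /andP[iI iJ].
  suff /eqP -> : dform22 r (i |: I, i |: J)%SET == 0 by rewrite mulr0.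
  apply: contraNT IJ => /dform22_out[]; rewrite !cardsU1 iI iJ !add1n.
  by move=> [->] [->].
rewrite mul1r !big_set1 [RHS](bigID (fun i => (i != j) && (i != l))) /=.
rewrite [X in _ = _ + X]big1 ?addr0 => [|i]; last first.
  by rewrite negb_and !negbK => /orP[]/eqP->; rewrite ?r0 ?r0'.
apply: eq_big => [i|i]; first by rewrite !inE.
rewrite !inE => /andP[ij il]; rewrite srt // !shuffle_signE !big_set1.
by case: (j < i)%N; case: (l < i)%N; rewrite ?expr0 ?expr1; ring.
Qed.

(** The Kulkarni-Nomizu product: each of the four terms is a way of choosing one
    index in each pair for [h]. *)
Lemma dmul_dform11_dform11 (h b : 'I_n -> 'I_n -> R) :
  dmul (dform11 h) (dform11 b) =
  dform22 (fun i j k l =>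
    h i k * b j l + h j l * b i k - h i l * b j k - h j k * b i l).
Proof.
apply: dform22_ext => [I J nz|i j k l ij kl].
  suff : (#|I| == 2) && (#|J| == 2) by case/andP=> /eqP-> /eqP->.
  apply: contraNT nz => IJ; rewrite dmul_dform11; apply/eqP.
  apply: big1 => i iI; apply: big1 => j jJ; rewrite dform11E.
  case: (boolP (_ && _)) => [|_]; last by rewrite mul0r mulr0.
  have := cardsD1 i I; have := cardsD1 j J; rewrite iI jJ.
  move=> Jc Ic /andP[/eqP I1 /eqP J1]; case/negP: IJ.
  by rewrite Ic Jc I1 J1.
have ijn : i != j by rewrite neq_ltn ij.
have kln : k != l by rewrite neq_ltn kl.
have D1 (a b' : 'I_n) : a != b' -> ([set a; b']%SET :\ a) = [set b']%SET.
  move=> ab; apply/setP => c; rewrite !inE; case: (eqVneq c a) => // ->.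
  by rewrite (negPf ab).
have D2 (a b' : 'I_n) : a != b' -> ([set a; b']%SET :\ b') = [set a]%SET.
  by move=> ab; rewrite finset.setUC D1 // eq_sym.
rewrite dmul_dform11 !big_setU1 ?inE //= !big_set1 !big_setU1 ?inE //= !big_set1.
rewrite !D1 // !D2 // !dform11E !cards1 !big_set1 /= !shuffle_signE !big_set1.
rewrite ij kl ltnNge (ltnW ij) ltnNge (ltnW kl) /=.
by rewrite !mul1r !expr0 !expr1; ring.
Qed.

End CurvatureForms.

(** * Symmetry of second derivatives *)

Section SecondDerivatives.
Variables (R : realType) (V : normedModType R).
Implicit Types (f : V -> R) (x u v : V) (s r h : R).

Let line_quotient f x v s :
  (fun h => h^-1 *: (((fun s => f (x + s *: v)) \o shift s) (h *: 1) - f (x + s *: v)))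
  = (fun h => h^-1 *: ((f \o shift (x + s *: v)) (h *: v) - f (x + s *: v))).
Proof.
apply/funext => h /=; congr (_ *: (f _ - _)).
by rewrite [h%:A]mulr1 scalerDl addrCA.
Qed.

Lemma derivable_line f x v s :
  derivable (fun s : R => f (x + s *: v)) s 1 = derivable f (x + s *: v) v.
Proof. by rewrite /derivable (line_quotient f x v s). Qed.

Lemma derive_line f x v s :
  'D_1 (fun s : R => f (x + s *: v)) s = 'D_v f (x + s *: v).
Proof. by rewrite /derive (line_quotient f x v s). Qed.

Lemma MVT_derive (f : R -> R) h : 0 <= h ->
  (forall s, 0 <= s <= h -> derivable f s 1) ->
  exists2 s, 0 <= s <= h & f h - f 0 = 'D_1 f s * h.
Proof.
move=> h0 df; have [||s] := @MVT_segment R f (fun s => 'D_1 f s) 0 h h0.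
- move=> s; rewrite in_itv /= => /andP[/ltW s0 /ltW sh].
  by apply: derivableP; apply: df; rewrite s0.
- by apply: derivable_within_continuous => s; rewrite in_itv; exact: df.
by rewrite in_itv /= subr0 => sh ->; exists s.
Qed.

(** The mean value theorem applied to the increment of [f] in the direction [v],
    as a function along [u], and then to ['D_u f] along [v]. *)
Lemma second_difference f x u v h : 0 <= h ->
  (forall s r, 0 <= s <= h -> 0 <= r <= h ->
     derivable f (x + s *: u + r *: v) u
     /\ derivable ('D_u f) (x + s *: u + r *: v) v) ->
  exists s r, [/\ 0 <= s <= h, 0 <= r <= h &
    f (x + h *: u + h *: v) - f (x + h *: u) - f (x + h *: v) + f x
    = 'D_v ('D_u f) (x + s *: u + r *: v) * h * h].
Proof.
move=> h0 df.
have hh : 0 <= h <= h by rewrite h0 lexx.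
have h00 : 0 <= (0 : R) <= h by rewrite h0 lexx.
pose p r s := f ((x + r *: v) + s *: u).
have dp r s : 0 <= r <= h -> 0 <= s <= h -> derivable (p r) s 1.
  move=> rh sh; rewrite derivable_line addrAC; exact: (df s r sh rh).1.
have [|s sh] := @MVT_derive (p h \- p 0) h h0.
  by move=> s sh; apply: derivableB; apply: dp.
rewrite deriveB ?derive_line; [|exact: dp..].
pose q r := 'D_u f ((x + s *: u) + r *: v).
have [|r rh] := @MVT_derive q h h0.
  by move=> r rh; rewrite /q (derivable_line ('D_u f)); exact: (df s r sh rh).2.
rewrite /q (derive_line ('D_u f)) !scale0r !addr0 => qE pE; exists s, r; split=> //.
move: pE; rewrite /p /= !scale0r !addr0 [_ + h *: v + h *: u]addrAC.
rewrite [_ + h *: v + s *: u]addrAC qE => <-.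
by ring.
Qed.

Let dist_lt_half (a b q : R) :
  `|a - q| < `|a - b| / 2 -> `|b - q| < `|a - b| / 2 -> False.
Proof.
move=> aq bq; have := ler_distD q a b; rewrite [`|q - b|]distrC leNgt => /negP; apply.
by rewrite [ltRHS]splitr ltrD.
Qed.

(** Both mixed derivatives are limits of the same second difference quotient:
    if they differed, a small parallelogram would have a second difference quotient
    close to both of them. *)
Lemma derive_swap f x u v (D : set V) : open D -> D x ->
  (forall y, D y -> [/\ derivable f y u, derivable f y v,
     derivable ('D_u f) y v & derivable ('D_v f) y u]) ->
  {for x, continuous ('D_v ('D_u f))} -> {for x, continuous ('D_u ('D_v f))} ->
  'D_v ('D_u f) x = 'D_u ('D_v f) x.
Proof.
move=> oD Dx df cvu cuv; apply/eqP; apply/negPn/negP => neq.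
set A := 'D_v ('D_u f) x in neq *; set B := 'D_u ('D_v f) x in neq *.
have e0 : 0 < `|A - B| / 2 by rewrite divr_gt0 // normr_gt0 subr_eq0.
have near_x : \forall y \near x, [/\ D y, `|A - 'D_v ('D_u f) y| < `|A - B| / 2 &
   `|B - 'D_u ('D_v f) y| < `|A - B| / 2].
  have nD : \forall y \near x, D y by exact: open_nbhs_nbhs.
  have nA : \forall y \near x, `|A - 'D_v ('D_u f) y| < `|A - B| / 2.
    by move/cvgr_dist_lt : cvu; apply.
  have nB : \forall y \near x, `|B - 'D_u ('D_v f) y| < `|A - B| / 2.
    by move/cvgr_dist_lt : cuv; apply.
  by apply: filterS3 nD nA nB => y *; split.
have [d /= d0 dP] := (nbhs_ballP _ _).1 near_x.
(* The parallelogram with sides [h u] and [h v] lies in the ball of radius [d];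
   the [1] in [M] keeps it positive when [u] and [v] vanish. *)
pose M := `|u| + `|v| + 1.
have M0 : 0 < M by rewrite ltr_wpDl // addr_ge0.
pose h := d / 2 / M.
have h0 : 0 < h by rewrite !divr_gt0.
have inball s r : 0 <= s <= h -> 0 <= r <= h -> ball x d (x + s *: u + r *: v).
  move=> /andP[s0 sh] /andP[r0 rh]; rewrite -ball_normE /= -addrA opprD addNKr normrN.
  apply: (le_lt_trans (ler_normD _ _)); rewrite !normrZ !ger0_norm //.
  have : s * `|u| + r * `|v| <= h * (`|u| + `|v|).
    by rewrite mulrDr lerD // ler_wpM2r.
  move=> /le_lt_trans; apply; apply: (@le_lt_trans _ _ (h * M)).
    by rewrite ler_wpM2l ?(ltW h0) // lerDl.
  by rewrite /h divfK ?gt_eqF // ltr_pdivrMr // mulr_natr mulr2n ltrDl.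
have swap (y w z : V) : y + w + z = y + z + w by exact: addrAC.
have [|s [r [sh rh E1]]] := @second_difference f x u v h (ltW h0).
  by move=> s r sh rh; have [/df[]] := dP _ (inball _ _ sh rh).
have [|r' [s' [rh' sh' E2]]] := @second_difference f x v u h (ltW h0).
  move=> r' s' rh' sh'; rewrite (swap x (r' *: v) (s' *: u)).
  by have [/df[]] := dP _ (inball _ _ sh' rh').
rewrite (swap x (r' *: v) (s' *: u)) in E2.
rewrite (swap x (h *: v) (h *: u)) in E2.
have [_ + _] := dP _ (inball _ _ sh rh); have [_ _] := dP _ (inball _ _ sh' rh').
move: E1 E2; generalize ('D_v ('D_u f) (x + s *: u + r *: v)).
generalize ('D_u ('D_v f) (x + s' *: u + r' *: v)) => q q' E1 E2.
have hn : h != 0 by rewrite gt_eqF.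
have -> : q' = q.
  apply: (mulIf hn); apply: (mulIf hn); rewrite -E1 -E2; ring.
by move=> Bq Aq; exact: dist_lt_half Aq Bq.
Qed.

End SecondDerivatives.

(** * Second order jets *)

Section Jets.
Variables (R : realType) (n : nat).
Implicit Types (f g : 'rV[R]_n -> R) (x y v : 'rV[R]_n) (a b : 'I_n).

Local Notation e_ a := (delta_mx 0 a : 'rV[R]_n).

(** What the curvature at [x] uses of a coefficient of the metric. The closure
    under products and exponentials is a direct computation. *)
Definition jet2 x f : Prop :=
  [/\ \forall y \near x, forall a, derivable f y (e_ a),
      forall a b, derivable (partial a f) x (e_ b) &
      forall a b, partial a (partial b f) x = partial b (partial a f) x].

Lemma smooth_jet2 (D : set 'rV[R]_n) x f : open D -> D x -> smooth_on D f -> jet2 x f.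
Proof.
move=> oD Dx fs; have [df ddf] := fs 2%N.
have Dn : \forall y \near x, D y by exact: open_nbhs_nbhs.
split.
- apply: filterS Dn => y Dy a; apply: diff_derivable; exact: df y Dy.
- by move=> a b; have [dpf _] := ddf a; apply: diff_derivable; exact: dpf x Dx.
- move=> a b; apply: (@derive_swap _ _ f x (e_ b) (e_ a) D) => //.
  + move=> y Dy; split; try by apply: diff_derivable; exact: df y Dy.
      by have [dpf _] := ddf b; apply: diff_derivable; exact: dpf y Dy.
    by have [dpf _] := ddf a; apply: diff_derivable; exact: dpf y Dy.
  + by have [_ /(_ a)] := ddf b; exact.
  + by have [_ /(_ b)] := ddf a; exact.
Qed.

Lemma near_partial a f g x : (\forall y \near x, f y = g y) ->
  partial a f x = partial a g x.
Proof. exact: near_eq_derive. Qed.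

Lemma near_near_partial a f g x : (\forall y \near x, f y = g y) ->
  \forall y \near x, partial a f y = partial a g y.
Proof. by move/near_join; apply: filterS => y; exact: near_partial. Qed.

Lemma partialM a f g x : derivable f x (e_ a) -> derivable g x (e_ a) ->
  partial a (fun y => f y * g y) x = partial a f x * g x + f x * partial a g x.
Proof.
move=> df dg; apply: etrans (deriveM df dg) _.
by rewrite addrC; congr (_ + _); exact: mulrC.
Qed.

Lemma derivable_mul v f g x : derivable f x v -> derivable g x v ->
  derivable (fun y => f y * g y) x v.
Proof. exact: derivableM. Qed.

Lemma partialD a f g x : derivable f x (e_ a) -> derivable g x (e_ a) ->
  partial a (fun y => f y + g y) x = partial a f x + partial a g x.
Proof. exact: deriveD. Qed.

Lemma partialB a f g x : derivable f x (e_ a) -> derivable g x (e_ a) ->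
  partial a (fun y => f y - g y) x = partial a f x - partial a g x.
Proof. exact: deriveB. Qed.

Lemma partialZ a (c : R) f x : derivable f x (e_ a) ->
  partial a (fun y => c * f y) x = c * partial a f x.
Proof. exact: deriveMl. Qed.

Lemma partial_sum a m (f : 'I_m -> 'rV[R]_n -> R) x :
  (forall i, derivable (f i) x (e_ a)) ->
  partial a (fun y => \sum_i f i y) x = \sum_i partial a (f i) x.
Proof.
move=> df; rewrite /partial -derive_sum //.
suff -> : (fun y => \sum_i f i y) = \sum_i f i by [].
by apply/funext => y; rewrite fct_sumE.
Qed.

Lemma derivable_bigsum (I : Type) (r : seq I) (P : pred I) (f : I -> 'rV[R]_n -> R) x v :
  (forall i, derivable (f i) x v) -> derivable (fun y => \sum_(i <- r | P i) f i y) x v.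
Proof.
move=> df; elim: r => [|i r IHr].
  by under eq_fun do rewrite big_nil; exact: derivable_cst.
under eq_fun do rewrite big_cons.
by case: (P i); [exact: derivableD (df i) IHr|exact: IHr].
Qed.

Lemma derivable_bigprod (I : Type) (r : seq I) (P : pred I) (f : I -> 'rV[R]_n -> R) x v :
  (forall i, derivable (f i) x v) -> derivable (fun y => \prod_(i <- r | P i) f i y) x v.
Proof.
move=> df; elim: r => [|i r IHr].
  by under eq_fun do rewrite big_nil; exact: derivable_cst.
under eq_fun do rewrite big_cons.
by case: (P i); [exact: derivableM (df i) IHr|exact: IHr].
Qed.

Lemma derivable_det m (A : 'rV[R]_n -> 'M[R]_m) x v :
  (forall i j, derivable (fun y => A y i j) x v) -> derivable (fun y => \det (A y)) x v.
Proof.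
move=> dA; apply: derivable_bigsum => s; apply: derivableM (derivable_cst _ _ _) _.
by apply: derivable_bigprod => i; exact: dA.
Qed.

Lemma derivable_invmx m (A : 'rV[R]_n -> 'M[R]_m) x v i j :
  (\forall y \near x, A y \in unitmx) ->
  (forall i j, derivable (fun y => A y i j) x v) ->
  derivable (fun y => invmx (A y) i j) x v.
Proof.
move=> uA dA; have Ax := nbhs_singleton uA.
have invE : \forall y \near x, (\det (A y))^-1 * cofactor (A y) j i = invmx (A y) i j.
  by apply: filterS uA => y Ay; rewrite /invmx Ay !mxE.
apply: near_eq_derivable invE _; apply: derivableM.
  by apply: derivableV; [rewrite -unitfE -unitmxE|exact: derivable_det].
apply: derivableM (derivable_cst _ _ _) _; apply: derivable_det => k l.
suff -> : (fun y => row' j (col' i (A y)) k l) = (fun y => A y (lift j k) (lift i l)).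
  exact: dA.
by apply/funext => y; rewrite !mxE.
Qed.

(** The second derivatives of a product are computed together with their
    existence, since the conformal change needs the formula. *)
Lemma jet2M f g x : jet2 x f -> jet2 x g ->
  jet2 x (fun y => f y * g y) /\
  forall a b, partial a (partial b (fun y => f y * g y)) x =
    partial a (partial b f) x * g x + partial b f x * partial a g x
    + partial a f x * partial b g x + f x * partial a (partial b g) x.
Proof.
move=> [df ddf fS] [dg ddg gS].
have dfx := nbhs_singleton df; have dgx := nbhs_singleton dg.
have dfg : \forall y \near x, forall a, derivable (fun y => f y * g y) y (e_ a).
  by apply: filterS2 df dg => y dfy dgy a; exact: derivableM.
have pfg b : \forall y \near x, partial b (fun y => f y * g y) y
    = partial b f y * g y + f y * partial b g y.
  by apply: filterS2 df dg => y dfy dgy; exact: partialM.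
have E a b : partial a (partial b (fun y => f y * g y)) x =
    partial a (partial b f) x * g x + partial b f x * partial a g x
    + partial a f x * partial b g x + f x * partial a (partial b g) x.
  have d1 : derivable (fun y => partial b f y * g y) x (e_ a).
    exact: derivableM (ddf b a) (dgx a).
  have d2 : derivable (fun y => f y * partial b g y) x (e_ a).
    exact: derivableM (dfx a) (ddg b a).
  rewrite -addrA (near_partial a (pfg b)); apply: etrans (partialD d1 d2) _.
  exact: congr2 (partialM (ddf b a) (dgx a)) (partialM (dfx a) (ddg b a)).
split; last exact: E.
split; first exact: dfg.
  move=> a b.
  have pfg' : \forall y \near x, partial a f y * g y + f y * partial a g y =
     partial a (fun y => f y * g y) y by apply: filterS (pfg a) => y ->.
  apply: near_eq_derivable pfg' _; apply: derivableD.
    exact: derivableM (ddf a b) (dgx b).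
  exact: derivableM (dfx b) (ddg a b).
move=> a b; rewrite (E a b) (E b a) (fS b a) (gS b a).
exact: (congr1 (+%R^~ _) (addrAC _ _ _)).
Qed.

Lemma derivable_scale (c : R) f x v : derivable f x v ->
  derivable (fun y => c * f y) x v.
Proof. by move=> df; exact: derivableM (derivable_cst _ _ _) df. Qed.

Lemma derivable_expRM (c : R) f x v : derivable f x v ->
  derivable (fun y => expR (c * f y)) x v /\
  'D_v (fun y => expR (c * f y)) x = expR (c * f x) * (c * 'D_v f x).
Proof.
move=> df; pose F := fun s : R => c * f (x + s *: v).
have x0 : x + (0 : R) *: v = x by rewrite scale0r addr0.
have dF : is_derive (0 : R) 1 F (c * 'D_v f x).
  split; first by rewrite (derivable_line (fun y => c * f y)) x0; exact: derivable_scale.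
  rewrite (derive_line (fun y => c * f y)) x0; exact: deriveMl.
have [dE DE] := @is_derive1_comp R expR F 0 _ _ (is_derive_expR (F 0)) dF.
have := derivable_line (fun y => expR (c * f y)) x v 0; rewrite x0 => <-.
split; first exact: dE.
have := derive_line (fun y => expR (c * f y)) x v 0; rewrite x0 => <-.
by apply: etrans DE _; rewrite /F x0.
Qed.

Lemma jet2_expRM (c : R) f x : jet2 x f ->
  [/\ jet2 x (fun y => expR (c * f y)),
    forall a, partial a (fun y => expR (c * f y)) x
              = expR (c * f x) * (c * partial a f x) &
    forall a b, partial a (partial b (fun y => expR (c * f y))) x =
      expR (c * f x) * (c * partial a (partial b f) x
                        + c ^+ 2 * (partial a f x * partial b f x))].
Proof.
move=> [df ddf fS]; pose F y := expR (c * f y).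
have dF : \forall y \near x, forall a, derivable F y (e_ a).
  by apply: filterS df => y dfy a; have [] := derivable_expRM c (dfy a).
have pF a : \forall y \near x, partial a F y = F y * (c * partial a f y).
  by apply: filterS df => y dfy; have [_] := derivable_expRM c (dfy a).
have dG a b : derivable (fun y => c * partial a f y) x (e_ b).
  exact: derivable_scale (ddf a b).
have E a b : partial a (partial b F) x =
      F x * (c * partial a (partial b f) x + c ^+ 2 * (partial a f x * partial b f x)).
  rewrite (near_partial a (pF b)).
  apply: etrans (partialM (nbhs_singleton dF a) (dG b a)) _.
  rewrite (partialZ c (ddf b a)) (nbhs_singleton (pF a)).
  move: (F x) (partial a f x) (partial b f x) (partial a (partial b f) x) => F0 p q r.
  by ring.
split; last exact: E; last by move=> a; exact: nbhs_singleton (pF a).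
split; first exact: dF.
  move=> a b.
  have pF' : \forall y \near x, F y * (c * partial a f y) = partial a F y.
    by apply: filterS (pF a) => y ->.
  by apply: near_eq_derivable pF' _; exact: derivableM (nbhs_singleton dF b) (dG a b).
move=> a b; rewrite (E a b) (E b a) (fS b a); congr (_ * (_ + _ * _)).
exact: mulrC.
Qed.

End Jets.

(** * The curvature tensor in coordinates *)

Section Bilin.
Variables (R : realType) (n : nat).
Implicit Types (G : 'M[R]_n) (u v w : 'rV[R]_n).

Lemma bilinE G u v : bilin G u v = \sum_i \sum_j u 0 i * v 0 j * G i j.
Proof.
rewrite /bilin mxE exchange_big /=; apply: eq_bigr => j _.
by rewrite !mxE mulr_suml; apply: eq_bigr => i _; rewrite mulrAC.
Qed.

Lemma bilinDl G u u' v : bilin G (u + u') v = bilin G u v + bilin G u' v.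
Proof. by rewrite /bilin !mulmxDl mxE. Qed.

Lemma bilinDr G u v v' : bilin G u (v + v') = bilin G u v + bilin G u v'.
Proof. by rewrite /bilin linearD mulmxDr mxE. Qed.

Lemma bilinZl G (a : R) u v : bilin G (a *: u) v = a * bilin G u v.
Proof. by rewrite /bilin -!scalemxAl mxE. Qed.

Lemma bilinZr G (a : R) u v : bilin G u (a *: v) = a * bilin G u v.
Proof. by rewrite /bilin linearZ -scalemxAr mxE. Qed.

Lemma bilinZ (a : R) G u v : bilin (a *: G) u v = a * bilin G u v.
Proof. by rewrite /bilin -scalemxAr -scalemxAl mxE. Qed.

Lemma bilin_sym G u v : G^T = G -> bilin G u v = bilin G v u.
Proof.
move=> GT; have -> : bilin G u v = (u *m G *m v^T)^T 0 0 by rewrite [RHS]mxE.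
by rewrite !trmx_mul trmxK GT mulmxA.
Qed.

Lemma bilin_invmx_row G i v : G \in unitmx -> bilin (invmx G) (row i G) v = v 0 i.
Proof.
move=> Gu; rewrite /bilin -row_mul mulmxV // row1 mxE (bigD1 i) //= !mxE !eqxx mul1r.
by rewrite big1 ?addr0 // => j ji; rewrite !mxE eqxx (negPf ji) mul0r.
Qed.

Lemma invmx_sym G : G^T = G -> (invmx G)^T = invmx G.
Proof. by move=> GT; rewrite trmx_inv GT. Qed.

Lemma posdef_unitmx G : (forall u, u != 0 -> 0 < bilin G u u) -> G \in unitmx.
Proof.
move=> Gpos; rewrite -row_free_unit -kermx_eq0; apply/eqP/row_matrixP => i.
rewrite row0; apply/eqP/negPn/negP => ker0.
have := Gpos _ ker0; rewrite /bilin -row_mul mulmx_ker row0 mul0mx mxE ltxx //.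
Qed.

End Bilin.

Section LoweredCurvature.
Variables (R : realType) (n : nat) (G : 'rV[R]_n -> 'M[R]_n) (x : 'rV[R]_n).
Implicit Types (a b c d i j k m : 'I_n) (y : 'rV[R]_n).

Local Notation e_ a := (delta_mx 0 a : 'rV[R]_n).
Local Notation G_ i j := (fun y => G y i j).

(** What is used of a metric near [x]; invertibility replaces positive
    definiteness. *)
Definition metric_jet : Prop :=
  [/\ \forall y \near x, (G y)^T = G y, \forall y \near x, G y \in unitmx &
      forall i j, jet2 x (G_ i j)].

(** The Christoffel symbols of the first kind. *)
Definition lower_christoffel c a b y : R :=
  2^-1 * (partial a (G_ b c) y + partial b (G_ a c) y - partial c (G_ a b) y).

Definition christoffel_row y a b : 'rV[R]_n := \row_c lower_christoffel c a b y.

Definition metric_hess a b i j : R := partial a (partial b (G_ i j)) x.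

(** The components of the covariant curvature tensor, as they occur in
    [riemann]. *)
Definition curv4 a b c d : R := \sum_m G x m c * curv_op G m d a b x.

Hypothesis Gj : metric_jet.

Let Gsym : \forall y \near x, (G y)^T = G y. Proof. by case: Gj. Qed.
Let Gunit : \forall y \near x, G y \in unitmx. Proof. by case: Gj. Qed.
Let Gjet i j : jet2 x (G_ i j). Proof. by case: Gj. Qed.

Let G_C i j : \forall y \near x, G y i j = G y j i.
Proof. by apply: filterS Gsym => y Gy; rewrite -[in LHS]Gy mxE. Qed.

Lemma partial_metricC a i j : partial a (G_ i j) x = partial a (G_ j i) x.
Proof. exact: near_partial (G_C i j). Qed.

Lemma metric_hessC a b i j : metric_hess a b i j = metric_hess a b j i.
Proof. exact/near_partial/near_near_partial/G_C. Qed.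

Lemma metric_hess_swap a b i j : metric_hess a b i j = metric_hess b a i j.
Proof. by have [_ _] := Gjet i j; apply. Qed.

Let dG i j a : derivable (G_ i j) x (e_ a).
Proof. by have [/nbhs_singleton + _ _] := Gjet i j; apply. Qed.

Let ddG i j a b : derivable (partial a (G_ i j)) x (e_ b).
Proof. by have [_ + _] := Gjet i j; apply. Qed.

Lemma christoffel_sum c a b y :
  christoffel G c a b y = \sum_d invmx (G y) c d * lower_christoffel d a b y.
Proof. by rewrite /christoffel mulr_sumr; apply: eq_bigr => d _; rewrite mulrCA. Qed.

Lemma derivable_lower_christoffel c a b k :
  derivable (lower_christoffel c a b) x (e_ k).
Proof.
apply: derivable_scale; apply: derivableB; last exact: ddG.
by apply: derivableD; exact: ddG.
Qed.

Lemma derivable_christoffel c a b k : derivable (christoffel G c a b) x (e_ k).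
Proof.
have -> : christoffel G c a b =
   (fun y => \sum_d invmx (G y) c d * lower_christoffel d a b y).
  by apply/funext => y; exact: christoffel_sum.
apply: derivable_bigsum => d.
have dinv : derivable (fun y => invmx (G y) c d) x (e_ k).
  by apply: derivable_invmx Gunit _ => i j; exact: dG.
exact: derivable_mul dinv (@derivable_lower_christoffel d a b k).
Qed.

Lemma lower_christoffelE c a b : \forall y \near x,
  \sum_m G y m c * christoffel G m a b y = lower_christoffel c a b y.
Proof.
apply: filterS2 Gsym Gunit => y Gs Gu.
have -> : lower_christoffel c a b y =
    (christoffel_row y a b *m (invmx (G y))^T *m G y) 0 c.
  by rewrite (invmx_sym Gs) mulmxKV // mxE.
rewrite mxE; apply: eq_bigr => m _; rewrite mulrC christoffel_sum mxE.
by congr (_ * _); apply: eq_bigr => d _; rewrite !mxE mulrC.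
Qed.

Lemma partial_lower_christoffel k c a b :
  partial k (lower_christoffel c a b) x
  = 2^-1 * (metric_hess k a b c + metric_hess k b a c - metric_hess k c a b).
Proof.
have d1 : derivable (fun y => partial a (G_ b c) y + partial b (G_ a c) y) x (e_ k).
  by apply: derivableD; exact: ddG.
rewrite (partialZ _ (derivableB d1 (@ddG a b c k))).
by rewrite (partialB d1 (@ddG a b c k)) (partialD (@ddG b c a k) (@ddG a c b k)).
Qed.

(** The Levi-Civita connection is compatible with the metric. *)
Lemma partial_metricE a i j :
  partial a (G_ i j) x = lower_christoffel i a j x + lower_christoffel j a i x.
Proof.
rewrite /lower_christoffel (partial_metricC a j i).
move: (partial a _ x) (partial j _ x) (partial i _ x) => p q r; by field.
Qed.

Lemma bilin_christoffel_row (u : 'rV[R]_n) a b :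
  bilin (invmx (G x)) u (christoffel_row x a b) = \sum_m u 0 m * christoffel G m a b x.
Proof.
rewrite bilinE; apply: eq_bigr => m _; rewrite christoffel_sum mulr_sumr.
by apply: eq_bigr => d _; rewrite mxE -mulrA [X in _ * X]mulrC.
Qed.

(** Lowering an index does not commute with the derivative; the defect is the
    derivative of the metric, expressed by Christoffel symbols. *)
Let lowered_partial_christoffel k c a b :
  \sum_m G x m c * partial k (christoffel G m a b) x =
  partial k (lower_christoffel c a b) x
  - \sum_m (lower_christoffel m k c x + lower_christoffel c k m x)
           * christoffel G m a b x.
Proof.
have := near_partial k (lower_christoffelE c a b).
rewrite partial_sum => [<-|m]; last first.
  exact: derivable_mul (@dG m c k) (@derivable_christoffel m a b k).
rewrite -sumrB; apply: eq_bigr => m _.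
rewrite (partialM (@dG m c k) (@derivable_christoffel m a b k)) partial_metricE.
by rewrite addrAC subrr add0r.
Qed.

(** Half of the products of Christoffel symbols created by lowering the index
    cancel those of [curv_op]; the remaining ones are a quadratic form in the
    symbols of the first kind, which makes the symmetries visible. *)
Lemma curv4E a b c d :
  curv4 a b c d =
    partial a (lower_christoffel c b d) x - partial b (lower_christoffel c a d) x
    - bilin (invmx (G x)) (christoffel_row x a c) (christoffel_row x b d)
    + bilin (invmx (G x)) (christoffel_row x b c) (christoffel_row x a d).
Proof.
pose quad m := \sum_(k < n) (christoffel G k b d x * christoffel G m a k x
                  - christoffel G k a d x * christoffel G m b k x).
have -> : curv4 a b c d = \sum_m G x m c * partial a (christoffel G m b d) x
    - \sum_m G x m c * partial b (christoffel G m a d) x + \sum_m G x m c * quad m.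
  rewrite -sumrB -big_split; apply: eq_bigr => m _.
  have mulBD (t p q r : R) : t * (p - q + r) = t * p - t * q + t * r by ring.
  exact: mulBD.
have quadE : \sum_m G x m c * quad m
  = \sum_k lower_christoffel c a k x * christoffel G k b d x
    - \sum_k lower_christoffel c b k x * christoffel G k a d x.
  under eq_bigr do rewrite mulr_sumr.
  rewrite exchange_big -sumrB; apply: eq_bigr => k _ /=.
  rewrite -(nbhs_singleton (lower_christoffelE c a k)).
  rewrite -(nbhs_singleton (lower_christoffelE c b k)) !mulr_suml -sumrB.
  by apply: eq_bigr => m _; rewrite mulrBr mulrCA [in X in X - _]mulrC; ring.
apply: etrans (congr2 +%R (congr2 (fun p q => p - q)
  (lowered_partial_christoffel a c b d) (lowered_partial_christoffel b c a d)) quadE) _.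
rewrite /= !bilin_christoffel_row.
have split_sum k i j : \sum_m (lower_christoffel m k c x + lower_christoffel c k m x)
      * christoffel G m i j x
    = \sum_m christoffel_row x k c 0 m * christoffel G m i j x
      + \sum_m lower_christoffel c k m x * christoffel G m i j x.
  by rewrite -big_split; apply: eq_bigr => m _; rewrite mxE; exact: mulrDl.
rewrite (split_sum a b d) (split_sum b a d).
move: (partial a _ x) (partial b _ x) => p q.
move: (\sum_m christoffel_row x a c 0 m * _)
      (\sum_m christoffel_row x b c 0 m * _) => s1 s2.
move: (\sum_m lower_christoffel c a m x * _)
      (\sum_m lower_christoffel c b m x * _) => s3 s4.
by ring.
Qed.

(** The curvature in terms of the second derivatives of the metric and of a
    quadratic form [Q a c b d] in the Christoffel symbols. *)
Definition curv_expr (H Q : 'I_n -> 'I_n -> 'I_n -> 'I_n -> R) a b c d : R :=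
  2^-1 * (H a b d c + H a d b c - H a c b d)
  - 2^-1 * (H b a d c + H b d a c - H b c a d) - Q a c b d + Q b c a d.

Definition christoffel_quad a c b d : R :=
  bilin (invmx (G x)) (christoffel_row x a c) (christoffel_row x b d).

Lemma curv4_hess a b c d :
  curv4 a b c d = curv_expr metric_hess christoffel_quad a b c d.
Proof. by rewrite curv4E !partial_lower_christoffel. Qed.

Lemma lower_christoffelC c a b : lower_christoffel c a b x = lower_christoffel c b a x.
Proof.
rewrite /lower_christoffel (partial_metricC c b a).
by congr (_ * (_ - _)); exact: addrC.
Qed.

Lemma christoffel_quadC a c b d : christoffel_quad a c b d = christoffel_quad b d a c.
Proof. by apply/bilin_sym/invmx_sym; exact: nbhs_singleton Gsym. Qed.

(** The second derivatives of the metric commute, so both sides reduce to the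
    same four of them; the quadratic terms agree because [christoffel_quad] is
    symmetric. *)
Lemma curv4_sym a b c d : curv4 a b c d = curv4 c d a b.
Proof.
have rowC i j : christoffel_row x i j = christoffel_row x j i.
  by apply/rowP => k; rewrite !mxE lower_christoffelC.
rewrite !curv4_hess /curv_expr.
have -> : christoffel_quad c a d b = christoffel_quad a c b d.
  by rewrite /christoffel_quad (rowC c a) (rowC d b).
have -> : christoffel_quad d a c b = christoffel_quad b c a d.
  by rewrite christoffel_quadC /christoffel_quad (rowC c b) (rowC d a).
have HC := metric_hessC; have HS := metric_hess_swap; move: HC HS.
generalize metric_hess => H HC HS.
(* Sort all the indices, so that equal derivatives become the same term. *)
rewrite ?(HS b a) ?(HS c a) ?(HS d a) ?(HS c b) ?(HS d b) ?(HS d c).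
rewrite ?(HC _ _ b a) ?(HC _ _ c a) ?(HC _ _ d a) ?(HC _ _ c b)
        ?(HC _ _ d b) ?(HC _ _ d c).
by ring.
Qed.

End LoweredCurvature.

(** The conformal change of the curvature as an identity between the jets of the
    metric [g] and of the logarithm [f] of the conformal factor at a point: [H]
    and [D] are the second and first derivatives of [g], [h] and [p] those of
    [f], [N] is the squared length of [p], and [F a c] is the product of [p]
    with the Christoffel symbols. The factor is [phi = e ^ (2 f)], and [Ht] and
    [Qt] are the data of [phi g]. Thus [K] is the covariant Hessian of [f] minus
    [df * df] plus [|df|^2 g / 2]. *)
Section ConformalAlgebra.
Variables (R : realType) (n : nat).
Variables (H : 'I_n -> 'I_n -> 'I_n -> 'I_n -> R) (D : 'I_n -> 'I_n -> 'I_n -> R).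
Variables (g h F : 'I_n -> 'I_n -> R) (p : 'I_n -> R) (N phi : R).
Variable Q : 'I_n -> 'I_n -> 'I_n -> 'I_n -> R.
Hypothesis HC : forall a b i j, H a b i j = H a b j i.
Hypothesis DC : forall a i j, D a i j = D a j i.
Hypothesis gC : forall i j, g i j = g j i.
Hypothesis hC : forall i j, h i j = h j i.

Let gam c a b := 2^-1 * (D a b c + D b a c - D c a b).

Let Ht a b i j := phi * (H a b i j + 2 * p b * D a i j + 2 * p a * D b i j
                         + (2 * h a b + 4 * (p a * p b)) * g i j).

Let Qt a c b d := phi * (Q a c b d
  + p b * gam d a c + p d * gam b a c - g b d * F a c
  + p a * gam c b d + p c * gam a b d - g a c * F b d
  + p a * p b * g c d + p a * p d * g b c + p c * p b * g a d + p c * p d * g a b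
  - 2 * (p a * p c * g b d) - 2 * (p b * p d * g a c) + g a c * g b d * N).

Let K a c := h a c - p a * p c - F a c + 2^-1 * N * g a c.

Lemma conformal_curv_expr a b c d : curv_expr Ht Qt a b c d
  = phi * (curv_expr H Q a b c d
           - (g a c * K b d + g b d * K a c - g a d * K b c - g b c * K a d)).
Proof.
rewrite /curv_expr /Ht /Qt /K /gam.
rewrite ?(HC _ _ b a) ?(HC _ _ c a) ?(HC _ _ d a) ?(HC _ _ c b)
        ?(HC _ _ d b) ?(HC _ _ d c).
rewrite ?(DC _ b a) ?(DC _ c a) ?(DC _ d a) ?(DC _ c b) ?(DC _ d b) ?(DC _ d c).
rewrite ?(gC b a) ?(gC c a) ?(gC d a) ?(gC c b) ?(gC d b) ?(gC d c).
rewrite ?(hC b a) ?(hC c a) ?(hC d a) ?(hC c b) ?(hC d b) ?(hC d c).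
by field.
Qed.

End ConformalAlgebra.

(** * Conformal change of the metric *)

Section Conformal.
Variables (R : realType) (n : nat) (G : 'rV[R]_n -> 'M[R]_n) (x : 'rV[R]_n).
Variable f : 'rV[R]_n -> R.
Implicit Types (a b c d i j k m : 'I_n) (y : 'rV[R]_n).
Hypotheses (Gj : metric_jet G x) (fj : jet2 x f).

Local Notation e_ a := (delta_mx 0 a : 'rV[R]_n).

Definition conformal_metric y := expR (2 * f y) *: G y.

Local Notation phi y := (expR (2 * f y)).
Local Notation Gt := conformal_metric.

Let phi_jet : jet2 x (fun y => phi y). Proof. by case: (jet2_expRM 2 fj). Qed.
Let Gjet i j : jet2 x (fun y => G y i j). Proof. by have [_ _ J] := Gj; exact: J. Qed.

Let GtE i j : (fun y => Gt y i j) = (fun y => phi y * G y i j).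
Proof. by apply/funext => y; rewrite mxE. Qed.

Lemma conformal_metric_jet : metric_jet Gt x.
Proof.
case: Gj => Gs Gu _; split.
- by apply: filterS Gs => y Gy; rewrite /conformal_metric linearZ /= Gy.
- apply: filterS Gu => y Gy; rewrite /conformal_metric.
  by rewrite unitmxZ // unitfE gt_eqF // expR_gt0.
- by move=> i j; rewrite GtE; have [] := jet2M phi_jet (Gjet i j).
Qed.

Let p a := partial a f x.
Let D a i j := partial a (fun y => G y i j) x.

Let partial_Gt a i j :
  partial a (fun y => Gt y i j) x = phi x * (2 * p a * G x i j + D a i j).
Proof.
rewrite GtE; have [/nbhs_singleton dphi _ _] := phi_jet.
have [/nbhs_singleton dG _ _] := Gjet i j.
apply: etrans (partialM (dphi a) (dG a)) _.
have [_ -> _] := jet2_expRM 2 fj.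
rewrite -/(p a) -/(D a i j); move: (p a) (D a i j) => q r; by ring.
Qed.

Let hess_Gt a b i j : metric_hess Gt x a b i j =
  phi x * (metric_hess G x a b i j + 2 * p b * D a i j + 2 * p a * D b i j
     + (2 * partial a (partial b f) x + 4 * (p a * p b)) * G x i j).
Proof.
rewrite /metric_hess GtE; have [_ ->] := jet2M phi_jet (Gjet i j).
have [_ dphi ddphi] := jet2_expRM 2 fj; rewrite !dphi ddphi.
rewrite -/(p a) -/(p b) -/(D a i j) -/(D b i j).
move: (partial a (partial b f) x) (partial a (partial b _) x).
move: (p a) (p b) (D a i j) (D b i j).
by move=> ? ? ? ? ? ?; ring.
Qed.

Let grad : 'rV[R]_n := \row_a p a.

Let christoffel_row_Gt a b : christoffel_row Gt x a b =
  phi x *: (christoffel_row G x a b + p a *: row b (G x) + p b *: row a (G x)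
            - G x a b *: grad).
Proof.
apply/rowP => c; rewrite !mxE /lower_christoffel !partial_Gt.
rewrite -/(D a b c) -/(D b a c) -/(D c a b).
move: (p a) (p b) (p c) (D a b c) (D b a c) (D c a b) => ? ? ? ? ? ?; by field.
Qed.

(** The Christoffel symbols of [e^(2f) G] are obtained by adding terms linear in
    [df], so that the quadratic form in them expands into the expression of
    [conformal_curv_expr]; [row a G] is the coordinate vector [e_a] lowered, and
    pairing with it extracts a component. *)
Lemma conformal_curv4 : exists K : 'M[R]_n, forall a b c d,
  curv4 Gt x a b c d = phi x * (curv4 G x a b c d
    - (G x a c * K b d + G x b d * K a c - G x a d * K b c - G x b c * K a d)).
Proof.
have [/nbhs_singleton Gs /nbhs_singleton Gu _] := Gj.
pose B := bilin (invmx (G x)).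
have BS u v : B u v = B v u by apply/bilin_sym/invmx_sym.
have rowE i v : B (row i (G x)) v = v 0 i by exact: bilin_invmx_row.
have rowE' i v : B v (row i (G x)) = v 0 i by rewrite BS rowE.
have GC i j : G x i j = G x j i by rewrite -[in LHS]Gs mxE.
pose F a c := B grad (christoffel_row G x a c).
pose N := B grad grad.
pose h a b := partial a (partial b f) x.
exists (\matrix_(a, c) (h a c - p a * p c - F a c + 2^-1 * N * G x a c)) => a b c d.
rewrite (curv4_hess conformal_metric_jet) (curv4_hess Gj) !mxE.
have <- := @conformal_curv_expr R n (metric_hess G x) D (G x) h F p N (phi x)
  (christoffel_quad G x).
- rewrite /curv_expr !hess_Gt.
  have quadE i k j l : christoffel_quad Gt x i k j l = phi x * (christoffel_quad G x i k j l
  + p j * lower_christoffel G l i k x + p l * lower_christoffel G j i k x - G x j l * F i k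
  + p i * lower_christoffel G k j l x + p k * lower_christoffel G i j l x - G x i k * F j l
  + p i * p j * G x k l + p i * p l * G x j k + p k * p j * G x i l + p k * p l * G x i j
  - 2 * (p i * p k * G x j l) - 2 * (p j * p l * G x i k) + G x i k * G x j l * N).
    rewrite /christoffel_quad invmxZ; last first.
      by rewrite unitmxZ // unitfE gt_eqF // expR_gt0.
    rewrite !christoffel_row_Gt -(scaleNr (G x i k)) -(scaleNr (G x j l)) bilinZ.
    rewrite bilinZl bilinZr !bilinDl !bilinDr !bilinZl !bilinZr -/B.
    rewrite !rowE !rowE' (BS _ grad) -/N -/(F i k) -/(F j l) !mxE.
    rewrite (GC l k) (GC l i) (GC j i).
    rewrite mulKf; last by rewrite gt_eqF // expR_gt0.
    congr (_ * _).
    move: (B (christoffel_row G x i k) _) (p i) (p j) (p k) (p l) N (F i k) (F j l).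
    move: (lower_christoffel G l i k x) (lower_christoffel G j i k x).
    move: (lower_christoffel G k j l x) (lower_christoffel G i j l x).
    by move=> *; ring.
  by rewrite !quadE.
- exact: metric_hessC.
- exact: partial_metricC.
- exact: GC.
- by move=> i j; have [_ _] := fj; apply.
Qed.

End Conformal.

(** * The curvature tensor on vectors *)

Section RiemannComponents.
Variables (R : realType) (n : nat) (G : 'rV[R]_n -> 'M[R]_n) (x : 'rV[R]_n).
Implicit Types (u v w z : 'rV[R]_n) (P Q K : 'M[R]_n).

Lemma riemannE u v w z : riemann G x u v w z
  = \sum_a \sum_b \sum_c \sum_d u 0 a * v 0 b * w 0 c * z 0 d * curv4 G x a b c d.
Proof. by []. Qed.

Lemma riemann_delta a b c d :
  riemann G x (delta_mx 0 a) (delta_mx 0 b) (delta_mx 0 c) (delta_mx 0 d)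
  = curv4 G x a b c d.
Proof.
rewrite riemannE; generalize (curv4 G x) => C.
have pick (i : 'I_n) (F : 'I_n -> R) :
    \sum_j (delta_mx 0 i : 'rV[R]_n) 0 j * F j = F i.
  rewrite (bigD1 i) //= mxE !eqxx mul1r big1 ?addr0 // => j ji.
  by rewrite mxE eqxx (negPf ji) mul0r.
rewrite -[RHS](pick a (fun a => C a b c d)); apply: eq_bigr => a' _.
rewrite -[in RHS](pick b (fun b => C a' b c d)) mulr_sumr; apply: eq_bigr => b' _.
rewrite -[in RHS](pick c (fun c => C a' b' c d)) !mulr_sumr; apply: eq_bigr => c' _.
rewrite -[in RHS](pick d (fun d => C a' b' c' d)) !mulr_sumr; apply: eq_bigr => d' _.
by rewrite !mulrA.
Qed.

Lemma sum_tensor4 P Q u v w z :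
  \sum_a \sum_b \sum_c \sum_d u 0 a * v 0 b * w 0 c * z 0 d * (P a c * Q b d)
  = bilin P u w * bilin Q v z.
Proof.
rewrite !bilinE mulr_suml; apply: eq_bigr => a _.
rewrite mulr_sumr; apply: eq_bigr => b _.
rewrite mulr_suml; apply: eq_bigr => c _.
by rewrite mulr_sumr; apply: eq_bigr => d _; ring.
Qed.

(** The Kulkarni-Nomizu form of the components passes from the coordinate basis
    to arbitrary vectors by multilinearity. *)
Lemma riemann_kulkarni K u v w z :
  (forall a b c d, curv4 G x a b c d =
     G x a c * K b d + G x b d * K a c - G x a d * K b c - G x b c * K a d) ->
  riemann G x u v w z =
    bilin (G x) u w * bilin K v z + bilin (G x) v z * bilin K u w
    - bilin (G x) u z * bilin K v w - bilin (G x) v w * bilin K u z.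
Proof.
move=> CE; rewrite riemannE.
have swap P Q : bilin P u z * bilin Q v w =
    \sum_a \sum_b \sum_c \sum_d u 0 a * v 0 b * w 0 c * z 0 d * (P a d * Q b c).
  rewrite -sum_tensor4; apply: eq_bigr => a _; apply: eq_bigr => b _.
  rewrite exchange_big; apply: eq_bigr => c _; apply: eq_bigr => d _.
  by rewrite [_ * z 0 d * w 0 c]mulrAC.
rewrite [bilin (G x) v z * _]mulrC [bilin (G x) v w * _]mulrC !swap.
rewrite -(sum_tensor4 (G x) K u v w z) -(sum_tensor4 K (G x) u v w z).
rewrite -big_split -!sumrB; apply: eq_bigr => a _ /=.
rewrite -big_split -!sumrB; apply: eq_bigr => b _ /=.
rewrite -big_split -!sumrB; apply: eq_bigr => c _ /=.
rewrite -big_split -!sumrB; apply: eq_bigr => d _ /=.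
rewrite CE; ring.
Qed.

Lemma riemann_sym u v w z : metric_jet G x ->
  riemann G x u v w z = riemann G x w z u v.
Proof.
move=> Gj; rewrite !riemannE.
pose T a b c d := u 0 a * v 0 b * w 0 c * z 0 d * curv4 G x a b c d.
transitivity (\sum_a \sum_c \sum_b \sum_d T a b c d).
  by apply: eq_bigr => a _; rewrite exchange_big.
rewrite exchange_big; apply: eq_bigr => c _ /=.
transitivity (\sum_a \sum_d \sum_b T a b c d).
  by apply: eq_bigr => a _; rewrite exchange_big.
rewrite exchange_big; apply: eq_bigr => d _ /=.
apply: eq_bigr => a _; apply: eq_bigr => b _.
by rewrite /T (curv4_sym Gj); move: (curv4 _ _ _ _ _ _) => q; ring.
Qed.

End RiemannComponents.

Section Bidegree11.
Variables (R : realType) (n : nat).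
Implicit Types (om : dform R n).

Lemma dform11_ext om : (forall I J, om (I, J) != 0 -> #|I| = 1%N /\ #|J| = 1%N) ->
  om = dform11 (fun i j => om ([set i]%SET, [set j]%SET)).
Proof.
move=> om_out; apply/ffunP => -[I J]; rewrite dform11E.
have [/andP[/cards1P[i ->] /cards1P[j ->]]|IJ] := boolP (_ && _).
  by rewrite mul1r !big_set1.
by rewrite mul0r; apply/eqP; apply: contraNT IJ => /om_out[-> ->].
Qed.

Lemma dcontraction_dform22_out r I J :
  (dcontraction (dform22 r) : dform R n) (I, J) != 0 -> #|I| = 1%N /\ #|J| = 1%N.
Proof.
rewrite ffunE /= => nz.
suff : (#|I| == 1%N) && (#|J| == 1%N) by case/andP=> /eqP-> /eqP->.
apply: contraNT nz => IJ; apply/eqP; apply: big1 => i /andP[iI iJ].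
suff /eqP -> : dform22 r (i |: I, i |: J)%SET == 0 by rewrite mulr0.
apply: contraNT IJ => /dform22_out[]; rewrite !cardsU1 iI iJ !add1n.
by move=> [->] [->].
Qed.

Lemma dscalar_dcontraction_dform11 (h : 'I_n -> 'I_n -> R) :
  dscalar (dcontraction (dform11 h)) = \sum_i h i i.
Proof.
rewrite /dscalar ffunE /=; apply: eq_big => [i|i _]; first by rewrite !inE.
by rewrite !shuffle_sign0r !mul1r finset.setU0 dform11E !cards1 !big_set1 mul1r.
Qed.

Lemma dform11D (h h' : 'I_n -> 'I_n -> R) :
  dform11 (fun i j => h i j + h' i j) = dform11 h + dform11 h'.
Proof.
apply/ffunP => -[I J]; rewrite [RHS]ffunE !dform11E -mulrDr -big_split; congr (_ * _).
by apply: eq_bigr => i _; rewrite -big_split.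
Qed.

Lemma dform11Z a (h : 'I_n -> 'I_n -> R) :
  dform11 (fun i j => a * h i j) = a *: dform11 h.
Proof.
apply/ffunP => -[I J]; rewrite dform_scaleE !dform11E [RHS]mulrCA.
by congr (_ * _); rewrite mulr_sumr; apply: eq_bigr => i _; rewrite mulr_sumr.
Qed.

End Bidegree11.

(** * Gauss-Bonnet curvatures *)

Section PointwiseInvariants.
Variables (R : realType) (n : nat) (M : smooth_manifold R n).
Variables (g : riemannian_metric M) (p : M) (e : onframe g p).

Local Notation G := (gmx g (fchart e)).
Local Notation x := (chart (fchart e) p).
Local Notation kron i j := ((i == j)%:R : R).
Local Notation rie i j k l :=
  (riemann G x (fvec e i) (fvec e j) (fvec e k) (fvec e l)).

Lemma mem_chart_image (V : set M) : V p -> chart_image (fchart e) V x.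
Proof. by move=> Vp; exists p => //; split=> //; exact: fchart_dom. Qed.

Lemma frame_metric_jet : metric_jet G x.
Proof.
have Dx := mem_chart_image (V := setT) I.
have oD : open (chart_image (fchart e) (@setT M)) by exact: chart_image_open.
have nD : \forall y \near x, chart_image (fchart e) setT y by exact: open_nbhs_nbhs.
split.
- by apply: filterS nD => y Dy; exact: gmx_sym.
- by apply: filterS nD => y Dy; apply: posdef_unitmx; exact: gmx_posdef.
- by move=> i j; apply: smooth_jet2 oD Dx _; exact: gmx_smooth.
Qed.

Lemma metric_formE : metric_form e = dform11 (fun i j => kron i j).
Proof.
by congr dform11; apply/funext => i; apply/funext => j; exact: fvec_orthonormal.
Qed.

Lemma ricci_form_out (I J : {set 'I_n}) :
  ricci_form e (I, J) != 0 -> #|I| = 1%N /\ #|J| = 1%N.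
Proof. exact: dcontraction_dform22_out. Qed.

Lemma schouten_form_ricci : schouten_form e = dform11 (fun i j => (n%:R - 2)^-1 *
  (ricci_form e ([set i]%SET, [set j]%SET) + (- (scal e / (2 * (n%:R - 1)))) * kron i j)).
Proof.
by rewrite dform11Z dform11D dform11Z -(dform11_ext ricci_form_out) -metric_formE scaleNr.
Qed.

Lemma schouten_formE :
  schouten_form e = dform11 (fun i j => dform11_mx (schouten_form e) i j).
Proof.
rewrite {1}schouten_form_ricci; congr dform11; apply/funext => i; apply/funext => j.
by rewrite mxE schouten_form_ricci dform11E !cards1 !big_set1 mul1r.
Qed.

(** The symmetry of the Ricci tensor, inherited from the pair symmetry of the
    curvature tensor. *)
Lemma schouten_form_sym : (dform11_mx (schouten_form e))^T = dform11_mx (schouten_form e).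
Proof.
have ricS I J : ricci_form e (I, J) = ricci_form e (J, I).
  apply: dcontraction_sym => K L; apply: dform22_sym => i j k l.
  exact: riemann_sym frame_metric_jet.
apply/matrixP => i j; rewrite !mxE schouten_form_ricci !dform11E !cards1 !big_set1.
by rewrite ricS [i == j]eq_sym.
Qed.

Lemma schouten_form_balanced : balanced (schouten_form e).
Proof. by rewrite schouten_formE; exact: dform11_balanced. Qed.

Lemma metric_form_balanced : balanced (metric_form e).
Proof. by rewrite metric_formE; exact: dform11_balanced. Qed.

Lemma sigma_top k : (k <= n)%N ->
  dmul (dpow (metric_form e) (n - k)) (dpow (schouten_form e) k)
    ([set: 'I_n]%SET, [set: 'I_n]%SET)
  = (n - k)`!%:R * k`!%:R * sigma e k.
Proof.
move=> kn; rewrite metric_formE {1}schouten_formE.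
have matE : \matrix_(i, j) dform11_mx (schouten_form e) i j
    = dform11_mx (schouten_form e).
  by apply/matrixP => i j; rewrite mxE.
have topE := @elementary_symmetric_top R n
  (fun i j => dform11_mx (schouten_form e) i j) k kn.
rewrite matE in topE; exact: topE schouten_form_sym.
Qed.

(** The term of the binomial expansion without [W] is the [sigma_k] curvature,
    and the others are pairings with a Hodge dual. *)
Lemma gauss_bonnet_weyl k : (2 * k <= n)%N ->
  gauss_bonnet e k =
    ((n - k)`!%:R * k`!%:R) / (n - 2 * k)`!%:R * sigma e k
    + \sum_(i < k)
        k`!%:R / (i`!%:R * (k - i)`!%:R * (n - 2 * k)`!%:R)
        * dinner (hodge (dmul (dpow (metric_form e) (n - 2 * k + i))
                              (dpow (schouten_form e) i)))
                 (dpow (weyl_form e) (k - i)).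
Proof.
move=> kn; have kn' : (k <= n)%N by apply: leq_trans kn; rewrite leq_pmull.
have RE : riemann_form e = weyl_form e + dmul (metric_form e) (schouten_form e).
  by rewrite /weyl_form subrK.
have RB : balanced (weyl_form e + dmul (metric_form e) (schouten_form e)).
  by rewrite -RE; exact: dform22_balanced.
rewrite /gauss_bonnet dscalar_hodge RE.
rewrite (top_pow_decomposition _ _ metric_form_balanced schouten_form_balanced RB).
rewrite sum_ffunE big_ord_recr mulrDr addrC /=; congr (_ + _).
  rewrite ffunMnE binn mulr1n subnn /= dmul1r.
  have -> : (n - 2 * k + k = n - k)%N.
    by rewrite mul2n -addnn subnDA subnK // leq_subRL // addnn -mul2n.
  by rewrite sigma_top // mulrA [_^-1 * _]mulrC.
rewrite mulr_sumr; apply: eq_bigr => i _.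
rewrite ffunMnE dinner_hodge -[X in _ * X]mulr_natl mulrA; congr (_ * _).
have ik : (i <= k)%N by exact: ltnW.
rewrite -(bin_fact ik) !natrM.
have fact0 m : (m`!%:R : R) != 0 by rewrite pnatr_eq0 -lt0n fact_gt0.
by field; rewrite !fact0.
Qed.

Lemma open_chart_image i (V : set M) : open V -> open (chart_image i V).
Proof.
move=> oV; rewrite openE => _ [q [dq Vq] <-].
have Dq : chart_image i setT (chart i q) by exists q.
have nV : nbhs (chart_inv i (chart i q)) V.
  by rewrite chartK //; exact: open_nbhs_nbhs.
have nD : nbhs (chart i q) (chart_image i (@setT M)).
  by apply: open_nbhs_nbhs; split=> //; exact: chart_image_open.
apply: filterS2 nD (chart_inv_continuous Dq nV) => _ [q' [dq' _] <-].
by rewrite /= chartK // => Vq'; exists q'.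
Qed.

Let sum_kron_l (F : 'I_n -> R) i : \sum_j kron i j * F j = F i.
Proof.
rewrite (bigD1 i) //= eqxx mul1r big1 ?addr0 // => j ji.
by rewrite eq_sym (negPf ji) mul0r.
Qed.

(** If [Rm = g B], then contracting gives [Ric = (n - 2) B + (tr B) g] and
    [Scal = 2 (n - 1) tr B], whence [A = B]. *)
Lemma schouten_kulkarni (b : 'I_n -> 'I_n -> R) : (4 <= n)%N ->
  (forall i j k l, rie i j k l =
     kron i k * b j l + kron j l * b i k - kron i l * b j k - kron j k * b i l) ->
  weyl_form e = 0.
Proof.
move=> n4 rE; pose tr := \sum_i b i i.
have ricE : ricci_form e = dform11 (fun j l => (n%:R - 2) * b j l + tr * kron j l).
  rewrite /ricci_form /riemann_form dcontraction_dform22.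
  - congr dform11; apply/funext => j; apply/funext => l.
    transitivity (\sum_i (b j l + kron j l * b i i - kron l i * b j i - kron j i * b i l)).
      by apply: eq_bigr => i _; rewrite rE eqxx mul1r [i == l]eq_sym.
    rewrite !sumrB big_split /= sumr_const card_ord -mulr_sumr !sum_kron_l -/tr.
    by rewrite -mulr_natl; ring.
  - by move=> i j k l; rewrite !rE; ring.
  - by move=> i j k l; rewrite !rE; ring.
have n2 : (n%:R - 2 : R) != 0 by rewrite subr_eq0 eqr_nat gtn_eqF // (leq_trans _ n4).
have n1 : (n%:R - 1 : R) != 0 by rewrite subr_eq0 pnatr_eq1 gtn_eqF // (leq_trans _ n4).
have scalE : scal e = 2 * (n%:R - 1) * tr.
  rewrite /scal ricE dscalar_dcontraction_dform11 big_split /= -mulr_sumr -/tr.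
  under eq_bigr do rewrite eqxx mulr1.
  by rewrite sumr_const card_ord -mulr_natl; ring.
have schE : schouten_form e = dform11 b.
  rewrite /schouten_form ricE scalE metric_formE -scaleNr -dform11Z -dform11D -dform11Z.
  congr dform11; apply/funext => j; apply/funext => l.
  by field; rewrite n1 n2.
rewrite /weyl_form schE metric_formE dmul_dform11_dform11 /riemann_form.
rewrite (_ : (fun i j k l => rie i j k l) = fun i j k l => kron i k * b j l + kron j l * b i k
       - kron i l * b j k - kron j k * b i l) ?subrr //.
by do 4 (apply/funext => ?); rewrite rE.
Qed.

(** The conformal change expresses the curvature of a conformally flat metric as
    [g K]. *)
Lemma conformally_flat_weyl : (4 <= n)%N -> conformally_flat g -> weyl_form e = 0.
Proof.
move=> n4 /(_ p)[V [f [oV Vp fs flat]]].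
have Vx := mem_chart_image Vp.
have fj : jet2 x (fun y => f (chart_inv (fchart e) y)).
  exact: smooth_jet2 (open_chart_image oV) Vx (fs _).
have [K KE] := conformal_curv4 frame_metric_jet fj.
have CE a b c d : curv4 G x a b c d =
    G x a c * K b d + G x b d * K a c - G x a d * K b c - G x b c * K a d.
  have := KE a b c d; rewrite -riemann_delta (flat _ _ Vx) => /esym/eqP.
  by rewrite mulf_eq0 gt_eqF ?expR_gt0 //= subr_eq0 => /eqP.
apply: (@schouten_kulkarni (fun i j => bilin K (fvec e i) (fvec e j)) n4) => i j k l.
by rewrite (riemann_kulkarni _ _ _ _ CE) !fvec_orthonormal.
Qed.

End PointwiseInvariants.

Theorem theorem2p1 (R : realType) (n : nat) (M : smooth_manifold R n)
    (g : riemannian_metric M) (k : nat) (hn : (4 <= n)%N) (hk : (2 * k <= n)%N) :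
  (conformally_flat g ->
   forall (p : M) (e : onframe g p),
     gauss_bonnet e k =
       ((n - k)`!%:R * k`!%:R) / (n - 2 * k)`!%:R * sigma e k)
  /\
  (forall (p : M) (e : onframe g p),
     gauss_bonnet e k =
       ((n - k)`!%:R * k`!%:R) / (n - 2 * k)`!%:R * sigma e k
       + \sum_(i < k)
           k`!%:R / (i`!%:R * (k - i)`!%:R * (n - 2 * k)`!%:R)
           * dinner (hodge (dmul (dpow (metric_form e) (n - 2 * k + i))
                                 (dpow (schouten_form e) i)))
                    (dpow (weyl_form e) (k - i))).
Proof.
split=> [flat p e|p e]; last exact: gauss_bonnet_weyl.
rewrite gauss_bonnet_weyl // (conformally_flat_weyl e hn flat).
rewrite big1 ?addr0 // => i _.
have [m ->] : exists m, (k - i)%N = m.+1 by exists (k - i).-1; rewrite prednK // subn_gt0.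
have -> : dpow (0 : dform R n) m.+1 = 0 by exact: (mul0r (dpow 0 m : dalg R n)).
by rewrite /dinner big1 ?mulr0 // => IJ _; rewrite [X in _ * X]ffunE mulr0.
Qed.
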